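(* Let $H$ be a Krull monoid whose class group $G$ is free abelian with basis $(e_1,\ldots,e_r)$ for some $r\in\{2,3\}$. Let $G_P\subset G$ denote the set of classes containing prime divisors and suppose that $G_P=G_r^+\cup -G_r^+$, where $G_r^+=\{\sum_{i=1}^r\epsilon_ie_i:\epsilon_i\in\{0,1\},\text{ not all }\epsilon_i=0\}$. 1. Suppose $r=2$. Then $\mathsf c(H)=\mathsf t(H)=\mathsf D(G_P)=3$ and, for each $k\ge 2$, the set $\mathcal U_k(H)$ is an interval. Moreover, for all $k\ge 2$ and $j\in\{0,1\}$, $\rho_{2k+j}(H)=3k+j$. 2. Suppose $r=3$. Then $\mathsf c(H)=\mathsf D(G_P)=5$ and, for each $k\ge 2$, the set $\mathcal U_k(H)$ is an interval. Moreover, for all $k\ge 2$ and $j\in\{0,1\}$, $\rho_{2k+j}(H)=5k+j$.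
   Context: $\mathbb N$ is the set of positive integers, $\mathbb N_0=\mathbb N\cup\{0\}$. An interval is a set of consecutive integers. A monoid is a commutative cancellative semigroup with identity. For a monoid $H$, $H^\times$ is its group of units, $H_{\mathrm{red}}=\{aH^\times:a\in H\}$, $\mathsf q(H)$ its quotient group, $\mathcal A(H)$ its set of atoms (non-units $u$ such that $u=ab$ implies $a$ or $b$ is a unit). $\mathcal F(P)$ is the free abelian monoid with basis $P$. Krull monoids: a homomorphism $\varphi:H\to D$ is a divisor homomorphism if $\varphi(a)\mid\varphi(b)$ implies $a\mid b$; it is a divisor theory if moreover $D=\mathcal F(P)$ for some set $P$ and every $a\in\mathcal F(P)$ is $\gcd(\varphi(X))$ for some finite nonempty $X\subset H$. $H$ is Krull if it has a divisor homomorphism into a free abelian monoid; then it has a divisor theory $\varphi:H\to\mathcal F(P)$, unique up to isomorphism. Its class group is $\mathsf q(\mathcal F(P))/\mathsf q(\varphi(H))$, written additively, and $G_P=\{p\,\mathsf q(\varphi(H)):p\in P\}$ is the set of classes containing prime divisors. Factorizations: $\mathsf Z(H)=\mathcal F(\mathcal A(H_{\mathrm{red}}))$ and for $a\in H$, $\mathsf Z(a)$ is the set of $z\in\mathsf Z(H)$ whose product in $H_{\mathrm{red}}$ is $aH^\times$; $\mathsf L(a)=\{|z|:z\in\mathsf Z(a)\}$, where $|z|$ is the number of atoms in $z$ with multiplicity. $\mathcal U_k(H)$ is the union of all $\mathsf L(a)$ with $k\in\mathsf L(a)$ (and $\{k\}$ if $H=H^\times$); $\rho_k(H)=\sup\mathcal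 U_k(H)$. Catenary degree: $\mathsf d(z,z')=\max\{|z\gcd(z,z')^{-1}|,|z'\gcd(z,z')^{-1}|\}$. $\mathsf c(a)$ is the smallest $N\in\mathbb N_0\cup\{\infty\}$ such that any $z,z'\in\mathsf Z(a)$ can be joined by a finite chain $z=z_0,\ldots,z_k=z'$ in $\mathsf Z(a)$ with $\mathsf d(z_{i-1},z_i)\le N$ for all $i$; $\mathsf c(H)=\sup_{a\in H}\mathsf c(a)$. Tame degree: for an atom $u\in H_{\mathrm{red}}$, $\mathsf t(H,u)$ is the smallest $N\in\mathbb N_0\cup\{\infty\}$ such that for every multiple $a\in H_{\mathrm{red}}$ of $u$ and every factorization $z=v_1\cdots v_n\in\mathsf Z(a)$ not containing $u$, there is (after renumbering) a subproduct $v_1\cdots v_m$ that is a multiple of $u$ and a refactorization $v_1\cdots v_m=uu_2\cdots u_\ell$ into atoms with $\max\{\ell,m\}\le N$; $\mathsf t(H)=\sup_u\mathsf t(H,u)$. $\mathsf D(G_P)$ is the Davenport constant: the supremum of the lengths of minimal zero-sum sequences over $G_P$, i.e. nonempty finite multisets of elements of $G_P$ with sum $0$ and no proper nonempty sub-multiset with sum $0$. *)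

(* Defs.v *)
From HB Require Import structures.
From mathcomp Require Import all_boot all_order all_algebra ring_quotient.
From mathcomp Require Import generic_quotient.
From mathcomp Require Import boolp classical_sets.
From mathcomp Require Import finmap multiset.
From mathcomp Require Import freeg.

Set Implicit Arguments.
Unset Strict Implicit.
Unset Printing Implicit Defensive.

Import GRing.Theory.

Local Open Scope classical_set_scope.
Local Open Scope quotient_scope.
Local Open Scope ring_scope.

(* Monoids are written additively: a commutative monoid is an [nmodType], with
    [0] for the identity and [a + b] for the product. Cancellativity is not part
    of [nmodType]; it is the separate predicate [cancellative]. *)

(* [None] stands for infinity. *)

Definition enat := option nat.

Definition le_enat (x y : enat) : Prop :=
  match x, y with
  | _, None => True
  | None, Some _ => False
  | Some m, Some n => (m <= n)%N
  end.

(* The smallest natural number satisfying [Q], infinity if there is none. *)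
Definition least (Q : nat -> Prop) : enat :=
  match pselect (exists n, `[< Q n >]) with
  | left exQ => Some (ex_minn exQ)
  | right _ => None
  end.

(* Least upper bound; in particular the supremum of the empty set is 0. *)
Definition enat_sup (A : set enat) : enat :=
  least (fun N => forall x, A x -> le_enat x (Some N)).

Definition nat_interval (A : set nat) : Prop :=
  forall l m n, A l -> A n -> (l <= m <= n)%N -> A m.

Section Monoids.
Context (M : nmodType).
Implicit Types a b u : M.

Definition cancellative : Prop := forall a b c : M, a + b = a + c -> b = c.

Definition invertible a : Prop := exists b, a + b = 0.

Definition divides a b : Prop := exists c, b = a + c.

Definition atom u : Prop :=
  ~ invertible u /\ forall a b, u = a + b -> invertible a \/ invertible b.

(* Equality of the cosets of [a] and [b] modulo the group of units. *)
Definition assoc a b : bool := `[< exists2 e, invertible e & b = a + e >].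

Lemma invertibleD a b : invertible a -> invertible b -> invertible (a + b).
Proof.
by move=> [a' aa'] [b' bb']; exists (a' + b'); rewrite addrACA aa' bb' addr0.
Qed.

Lemma assoc_equiv : equiv_class_of assoc.
Proof.
have sym x y : assoc x y -> assoc y x.
  move=> /asboolP[e [e' ee'] ->]; apply/asboolP; exists e'.
    by exists e; rewrite addrC.
  by rewrite -addrA ee' addr0.
split=> [x|x y|y x z].
- by apply/asboolP; exists 0; [exists 0; rewrite addr0|rewrite addr0].
- by apply/idP/idP; apply: sym.
- move=> /asboolP[e ie ->] /asboolP[f jf ->]; apply/asboolP.
  by exists (e + f); [apply: invertibleD|rewrite addrA].
Qed.

Canonical assoc_equiv_rel := EquivRelPack assoc_equiv.
Canonical assoc_enc_mod_rel := defaultEncModRel assoc.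

Definition reduced_monoid := {eq_quot assoc}.

HB.instance Definition _ : EqQuotient M assoc reduced_monoid :=
  EqQuotient.on reduced_monoid.
HB.instance Definition _ := Choice.on reduced_monoid.

Definition red_zero : reduced_monoid := lift_cst reduced_monoid 0.
Definition red_add := lift_op2 reduced_monoid +%R.

Canonical pi_red_zero_morph := PiConst red_zero.

Lemma pi_red_add : {morph \pi : x y / x + y >-> red_add x y}.
Proof.
move=> x y /=; unlock red_add; apply/eqP; rewrite piE.
have rep z : assoc z (repr (\pi_reduced_monoid z)).
  by have /eqmodP := esym (reprK (\pi_reduced_monoid z)).
have /asboolP[e ie ->] := rep x; have /asboolP[f jf ->] := rep y.
apply/asboolP; exists (e + f); first exact: invertibleD.
by rewrite addrACA.
Qed.
Canonical pi_red_add_morph := PiMorph2 pi_red_add.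

Lemma red_addA : associative red_add.
Proof. by move=> x y z; rewrite -[x]reprK -[y]reprK -[z]reprK !piE addrA. Qed.

Lemma red_addC : commutative red_add.
Proof. by move=> x y; rewrite -[x]reprK -[y]reprK !piE addrC. Qed.

Lemma red_add0 : left_id red_zero red_add.
Proof. by move=> x; rewrite -[x]reprK !piE add0r. Qed.

HB.instance Definition _ :=
  GRing.isNmodule.Build reduced_monoid red_addA red_addC red_add0.

Definition coset (a : M) : reduced_monoid := \pi a.

End Monoids.

Arguments cancellative M : clear implicits.
Arguments reduced_monoid M : clear implicits.

(* [multiset P], with multiset sum as addition, is the free abelian monoid with
   basis [P]. *)

Section FreeMonoid.
Context (P : choiceType).

Lemma mset_add0 : left_id (@mset0 P) (@msetD P).
Proof. exact: mset0D. Qed.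

HB.instance Definition _ :=
  Choice.copy (multiset P) {fsfun P -> nat with 0%N}.
HB.instance Definition _ :=
  GRing.isNmodule.Build (multiset P) (@msetDA P) (@msetDC P) mset_add0.
HB.instance Definition _ := GRing.Nmodule.copy {mset P}%mset (multiset P).

(* The embedding of the free abelian monoid with basis [P] into its quotient
   group, the free abelian group with basis [P]. *)
Definition mset_freeg (A : multiset P) : {freeg P} := \sum_(p <- A) << p >>.

End FreeMonoid.

Section Arithmetic.
Context (H : nmodType).

Definition red_atom := {u : reduced_monoid H | `[< atom u >]}.
HB.instance Definition _ := Choice.on red_atom.

Local Notation factorization := (multiset red_atom).

Definition fact_prod (z : factorization) : reduced_monoid H :=
  \sum_(u <- z) val u.

Definition factorizations_red (a : reduced_monoid H) : set factorization :=
  [set z | fact_prod z = a].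

Definition factorizations (a : H) : set factorization :=
  factorizations_red (coset a).

Definition lengths (a : H) : set nat :=
  [set size z | z in factorizations a].

(* The first disjunct is the convention for a monoid that is a group. *)
Definition unions_of_lengths (k : nat) : set nat :=
  [set l | ((forall a : H, invertible a) /\ l = k) \/
           exists a, lengths a k /\ lengths a l].

Definition elasticity (k : nat) : enat :=
  enat_sup [set Some l | l in unions_of_lengths k].

Definition fact_dist (z z' : factorization) : nat :=
  maxn (size (z `\` (z `&` z'))%mset) (size (z' `\` (z `&` z'))%mset).

Definition chain_connected (a : H) (N : nat) (z z' : factorization) : Prop :=
  exists s : seq factorization,
    [/\ path (fun x y => (fact_dist x y <= N)%N) z s, last z s = z'
      & forall y, y \in s -> factorizations a y].

Definition catenary_degree_at (a : H) : enat :=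
  least (fun N => forall z z', factorizations a z -> factorizations a z' ->
           chain_connected a N z z').

Definition catenary_degree : enat :=
  enat_sup [set catenary_degree_at a | a in setT].

(* [x] is the subproduct of [z], and [u] together with [y] is its
   refactorization, of length [(size y).+1]. *)
Definition tame_degree_at (u : red_atom) : enat :=
  least (fun N => forall (a : reduced_monoid H) (z : factorization),
    divides (val u) a -> factorizations_red a z -> u \notin z ->
    exists x y : factorization,
      [/\ (x `<=` z)%mset, fact_prod x = val u + fact_prod y
        & (maxn (size y).+1 (size x) <= N)%N]).

Definition tame_degree : enat :=
  enat_sup [set tame_degree_at u | u in setT].

End Arithmetic.

Arguments unions_of_lengths H k : clear implicits.
Arguments elasticity H k : clear implicits.
Arguments catenary_degree H : clear implicits.
Arguments tame_degree H : clear implicits.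

Section Davenport.
Context (G : zmodType).

Definition zero_sum (S : multiset G) : Prop := \sum_(g <- S) g = 0.

Definition minimal_zero_sum (S : multiset G) : Prop :=
  [/\ S <> mset0, zero_sum S
    & forall T : multiset G,
        (T `<=` S)%mset -> T <> mset0 -> T <> S -> ~ zero_sum T].

Definition davenport (G0 : set G) : enat :=
  enat_sup [set Some (size (S : multiset G)) | S in
    [set S : multiset G | minimal_zero_sum S /\ forall g, g \in S -> G0 g]].

Definition free_basis (r : nat) (e : 'I_r -> G) : Prop :=
  forall g, exists! c : {ffun 'I_r -> int}, g = \sum_(i < r) e i *~ c i.

(* The sums of the nonempty subfamilies of [e]. *)
Definition Gplus (r : nat) (e : 'I_r -> G) : set G :=
  [set g | exists eps : {ffun 'I_r -> bool},
     (exists i, eps i) /\ g = \sum_(i < r) e i *+ eps i].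

End Davenport.

Definition divisor_hom (H D : nmodType) (phi : {additive H -> D}) : Prop :=
  forall a b, divides (phi a) (phi b) -> divides a b.

Definition krull (H : nmodType) : Prop :=
  exists (P : choiceType) (phi : {additive H -> multiset P}), divisor_hom phi.

Section DivisorTheory.
Context (H : nmodType) (P : choiceType) (phi : {additive H -> multiset P}).

Definition is_gcd_image (X : {fset H}) (d : multiset P) : Prop :=
  (forall x, x \in X -> divides d (phi x)) /\
  forall d', (forall x, x \in X -> divides d' (phi x)) -> divides d' d.

Definition divisor_theory : Prop :=
  divisor_hom phi /\
  forall d : multiset P, exists2 X : {fset H}, X != fset0 & is_gcd_image X d.

(* The quotient group of the image of [phi], inside the free abelian group. *)
Definition principal (x : {freeg P}) : bool :=
  `[< exists a b, x = mset_freeg (phi a) - mset_freeg (phi b) >].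

Lemma mset_freegD (A B : multiset P) :
  mset_freeg (A + B) = mset_freeg A + mset_freeg B.
Proof.
rewrite /mset_freeg -big_cat; apply: perm_big.
apply/allP => p _ /=; apply/eqP.
by rewrite count_cat !count_mem_mset msetE2.
Qed.

Lemma principal_zmod_closed : zmod_closed principal.
Proof.
split; first by apply/asboolP; exists 0, 0; rewrite subrr.
move=> _ _ /asboolP[a [b ->]] /asboolP[c [d ->]]; apply/asboolP.
exists (a + d), (b + c); rewrite !(raddfD phi) !mset_freegD opprB.
by rewrite opprD [- _ - _]addrC addrACA [_ + - _ in RHS]addrC.
Qed.

HB.instance Definition _ :=
  GRing.isZmodClosed.Build {freeg P} principal principal_zmod_closed.

Definition principal_zmod : zmodClosed {freeg P} :=
  GRing.ZmodClosed.clone _ principal _.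

Definition class_group : zmodType := Quotient.quot principal_zmod.

Definition prime_class (p : P) : class_group :=
  \pi_(Quotient.quot principal_zmod) (<< p >> : {freeg P}).

Definition prime_classes : set class_group := range prime_class.

End DivisorTheory.

Arguments prime_class [H P] phi p.
Arguments prime_classes [H P] phi.

(* Main.v *)
Require Import Defs.
From mathcomp Require Import all_boot all_order all_algebra.
From mathcomp Require Import boolp classical_sets.
From mathcomp Require Import finmap multiset.
From mathcomp Require Import ring_quotient generic_quotient freeg zify.

(* Modulo units, H is the monoid of zero-sum multisets over the primes, a prime
   being weighted by its class, a vector with entries in {0,1} or {0,-1}. The
   minimal zero-sum sequences of such vectors form a finite list, found by a
   search: their lengths are at most D, with D = 3 for r = 2 and D = 5 for
   r = 3.
   The catenary degree is at most D: if u is a shortest atom dividing a, then in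
   any factorization of a at most |u| atoms cover u, and the rest of their
   product is a product of at most D - 1 atoms, since all these have length at
   least |u|; so any two factorizations are one step away from sharing u.
   For U of length D, the product U(-U) has only the factorization into two
   atoms and those into D pairs g(-g), whence equality.
   Since G_P = -G_P, each length d <= D yields an element with lengths 2 and d,
   and products of these realize all l with k <= l <= rho(k) in U_k, where
   rho(k) = D * floor(k/2) + (k mod 2). Hence U_k consists of the l with
   l <= rho(k) and k <= rho(l), once rho bounds all lengths. For D = 5 and odd
   k this bound is one better than the trivial one, which follows from the
   parities of the multiplicities of the classes up to sign.
   For r = 2, the atoms of length 3 have only two types, so three of them that
   meet an atom of length 3 have its type and leave at most two atoms: this
   bounds the tame degree. *)

Set Implicit Arguments.
Unset Strict Implicit.
Unset Printing Implicit Defensive.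

Import Order.TTheory GRing.Theory Num.Theory.

Local Open Scope classical_set_scope.
Local Open Scope quotient_scope.
Local Open Scope ring_scope.

(** * Least elements and suprema in the extended natural numbers *)

Lemma least_eq (Q : nat -> Prop) n :
  Q n -> (forall m, (m < n)%N -> ~ Q m) -> least Q = Some n.
Proof.
move=> Qn minn; rewrite /least; case: pselect => [exQ|[]]; last first.
  by exists n; apply/asboolP.
case: ex_minnP => m /asboolP Qm le_m; congr Some; apply/eqP.
rewrite eqn_leq le_m ?andTb; last exact/asboolP.
by rewrite leqNgt; apply/negP => /minn; apply.
Qed.

Lemma least_le (Q : nat -> Prop) n : Q n -> le_enat (least Q) (Some n).
Proof.
move=> Qn; rewrite /least; case: pselect => [exQ|[]]; last first.
  by exists n; apply/asboolP.
by case: ex_minnP => m _; apply; apply/asboolP.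
Qed.

Lemma least_ge (Q : nat -> Prop) n :
  (forall m, Q m -> (n <= m)%N) -> le_enat (Some n) (least Q).
Proof.
move=> ge_n; rewrite /least; case: pselect => // exQ.
by case: ex_minnP => m /asboolP /ge_n.
Qed.

Lemma enat_sup_max (A : set enat) n :
  A (Some n) -> (forall x, A x -> le_enat x (Some n)) -> enat_sup A = Some n.
Proof.
by move=> An ubn; apply: least_eq => // m mn /(_ _ An) /=; rewrite leqNgt mn.
Qed.

(** * Minimal zero-sum sequences *)

Section ZeroSumLists.
Context (V : zmodType).
Implicit Types s t : seq V.

Definition lsum s := foldr +%R 0 s.

Definition minimal_zs s : Prop :=
  [/\ s != [::], lsum s = 0
    & forall s1 s2, perm_eq s (s1 ++ s2) -> lsum s1 = 0 ->
        s1 = [::] \/ s2 = [::]].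

Lemma lsumE s : lsum s = \sum_(x <- s) x.
Proof. by rewrite unlock. Qed.

Lemma lsum_cat s t : lsum (s ++ t) = lsum s + lsum t.
Proof. by rewrite !lsumE big_cat. Qed.

Lemma perm_lsum s t : perm_eq s t -> lsum s = lsum t.
Proof. by move=> st; rewrite !lsumE; apply: perm_big. Qed.

Lemma lsumN s : lsum [seq - x | x <- s] = - lsum s.
Proof. by rewrite !lsumE big_map sumrN. Qed.

Lemma perm_minimal_zs s t : perm_eq s t -> minimal_zs s -> minimal_zs t.
Proof.
move=> st [s0 sum_s min_s]; split.
- by rewrite -size_eq0 -(perm_size st) size_eq0.
- by rewrite -(perm_lsum st).
- by move=> s1 s2 ts; apply: min_s; apply: perm_trans ts.
Qed.

Lemma minimal_zsN s : minimal_zs s -> minimal_zs [seq - x | x <- s].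
Proof.
move=> [s0 sum_s min_s]; split; first by case: (s) s0.
  by rewrite lsumN sum_s oppr0.
move=> s1 s2 /(perm_map -%R); rewrite mapK; last exact: opprK.
rewrite map_cat => /min_s + s10; rewrite lsumN s10 oppr0 => /(_ erefl).
by case=> /eqP; rewrite -size_eq0 size_map size_eq0 => /eqP; [left|right].
Qed.

Lemma minimal_zs_pair x : x != 0 -> minimal_zs [:: x; - x].
Proof.
move=> x0; split; rewrite //= ?addr0 ?subrr // => s1 s2 p s10.
have := perm_size p; rewrite size_cat /=.
case: s1 s10 p => [|a [|b s1]] s10 p; first by left.
- have : a \in [:: x; - x] by rewrite (perm_mem p) mem_head.
  move: s10; rewrite /= addr0 => ->; rewrite !inE eq_sym (negPf x0).
  by rewrite eq_sym oppr_eq0 (negPf x0).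
- by case: s2 {p} => [|c s2]; [right|rewrite /= addnS].
Qed.

(* A zero sum leaves, outside the elements already taken, some element of
   negative inner product with their sum; taking it first keeps partial sums
   short, so the tree of zero-sum free prefixes explored here is finite. *)
Fixpoint zs_search (ip : V -> V -> int) (G : seq V) (Q : pred (seq V))
    (n : nat) (pre sums : seq V) (x : V) : bool :=
  if n is n'.+1 then
    all (fun g =>
      if (ip g x < 0)%R then
        if g == - x then Q (g :: pre)
        else if - g \in sums then true
        else zs_search ip G Q n' (g :: pre)
               (g :: sums ++ [seq g + y | y <- sums]) (g + x)
      else true) G
  else false.

(** The elements of [rest] sum to [- x], where [x] is the sum of [pre], and [ip (- x) x] is
    negative; hence some [g] in [rest] has [ip g x] negative, and one branch of the search follows
    [s]. If [- g] is in [sums], then [g] and a part of the prefix have sum zero while [rem g rest]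
    is nonempty, against minimality, so this branch may be cut. Exhausted fuel returns [false], so a
    successful search has covered every [s]. *)
Lemma zs_searchP (ip : V -> V -> int) (G : seq V) (Q : pred (seq V)) :
    (forall x y z, ip (x + y) z = ip x z + ip y z) ->
    (forall x, x != 0 -> (0 < ip x x)%R) ->
    (forall s t, perm_eq s t -> Q s = Q t) ->
    forall n pre rest sums s,
  zs_search ip G Q n pre sums (lsum pre) ->
  (forall y, y \in sums -> exists s1 s2,
     [/\ perm_eq pre (s1 ++ s2), s1 != [::] & lsum s1 = y]) ->
  minimal_zs s -> {subset s <= G} -> perm_eq s (pre ++ rest) ->
  pre != [::] -> rest != [::] -> Q s.
Proof.
move=> ipD ip_pos permQ; elim=> [|n IH] // pre rest sums s /allP search sumsP.
move=> min_s sG s_pr pre0 rest0.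
have [s0 sum_s dec_s] := min_s.
have ip0 z : ip 0 z = 0.
  by apply: (addrI (ip 0 z)); rewrite -ipD !addr0.
have ipN x z : ip (- x) z = - ip x z.
  by apply: (addIr (ip x z)); rewrite -ipD !addNr ip0.
set x := lsum pre in search.
have x0 : x != 0.
  by apply/eqP => /(dec_s _ _ s_pr) [] /eqP; apply/negP.
have sum_rest : lsum rest = - x.
  apply: (addrI x); rewrite subrr -sum_s (perm_lsum s_pr) lsum_cat.
  by [].
have [g g_rest ipg] : exists2 g, g \in rest & (ip g x < 0)%R.
  apply: contrapT => nog.
  have : (0 <= ip (lsum rest) x)%R.
    elim: (rest) nog => [|g r IHr] nog /=; first by rewrite ip0.
    rewrite ipD addr_ge0 //.
      rewrite leNgt; apply/negP => ?; apply: nog.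
      by exists g; rewrite ?mem_head.
    by apply: IHr => -[h hr ?]; apply: nog; exists h; rewrite ?inE ?hr ?orbT.
  by rewrite sum_rest ipN oppr_ge0 leNgt ip_pos.
have gG : g \in G by apply: sG; rewrite (perm_mem s_pr) mem_cat g_rest orbT.
have s_gpr : perm_eq s ((g :: pre) ++ rem g rest).
  apply: (perm_trans s_pr); rewrite cat_cons -cat1s perm_sym perm_catCA.
  by rewrite perm_cat2l perm_sym perm_to_rem.
have := search _ gG; rewrite ipg; case: eqP => [gx Qg|/eqP gx].
  rewrite (permQ _ (g :: pre)) //.
  have /(dec_s _ _ s_gpr) [] // : lsum (g :: pre) = 0.
    by rewrite /= gx addNr.
  by move=> r0; rewrite r0 cats0 in s_gpr.
have gpre_nz : lsum (g :: pre) != 0.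
  by rewrite /= addr_eq0.
have rem0 : rem g rest != [::].
  apply/eqP => r0; move: gpre_nz; rewrite r0 cats0 in s_gpr.
  by rewrite -(perm_lsum s_gpr) sum_s eqxx.
case: ifP => [/sumsP[s1 [s2 [pre_s s10 sum_s1]]] _|_ sea].
  have : perm_eq s ((g :: s1) ++ (s2 ++ rem g rest)).
    by apply: (perm_trans s_gpr); rewrite /= perm_cons catA perm_cat2r.
  move/dec_s; rewrite /= sum_s1 subrr => /(_ erefl) [] // /eqP.
  by rewrite -size_eq0 size_cat addn_eq0 !size_eq0 (negPf rem0) andbF.
apply: (IH (g :: pre) (rem g rest) _ s sea) => //.
move=> y; rewrite inE mem_cat => /or3P[/eqP->|/sumsP[s1 [s2 [? ? ?]]]|].
- by exists [:: g], pre; rewrite /= addr0.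
- exists s1, (g :: s2); split=> //.
  by rewrite perm_sym -[g :: s2]cat1s perm_catCA /= perm_cons perm_sym.
- move=> /mapP[z /sumsP[s1 [s2 [p1 s10 <-]]] ->].
  by exists (g :: s1), s2; rewrite /= perm_cons.
Qed.

Fixpoint subs s : seq (seq V) :=
  if s is x :: s' then [seq x :: t | t <- subs s'] ++ subs s' else [:: [::]].

Lemma mem_subs s t : subseq t s -> t \in subs s.
Proof.
elim: s t => [|x s IHs] [|y t] //=; rewrite mem_cat => st.
- by rewrite IHs ?sub0seq ?orbT.
- move: st; case: eqP => [-> /IHs st|_ /IHs ->]; last by rewrite orbT.
  by rewrite map_f.
Qed.

Lemma perm_cat_subs s s1 s2 :
  perm_eq s (s1 ++ s2) -> exists2 t, t \in subs s & perm_eq s1 t.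
Proof.
move=> p; have /count_subseqP[t /mem_subs ts s1t] : 
    forall x, (count_mem x s1 <= count_mem x s)%N.
  by move=> x; rewrite (permP p) count_cat leq_addr.
by exists t.
Qed.

(** A computable test for concrete sequences: up to order, every part of a decomposition of [s] is
    one of its sublists. *)
Definition minimal_zsb s : bool :=
  [&& s != [::], lsum s == 0
    & all (fun t => (lsum t == 0) ==> (t == [::]) || (size t == size s))
        (subs s)].

Lemma minimal_zsbP s : minimal_zsb s -> minimal_zs s.
Proof.
case/and3P => s0 /eqP sum_s /allP all_s; split=> // s1 s2 p s10.
have [t ts s1t] := perm_cat_subs p.
have := all_s _ ts; rewrite -(perm_lsum s1t) s10 eqxx -size_eq0.
rewrite -(perm_size s1t) size_eq0 => /orP[/eqP->|/eqP s1s]; [by left|right].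
have := perm_size p; rewrite size_cat s1s => /eqP.
by rewrite -[X in X == _]addn0 eqn_add2l eq_sym size_eq0 => /eqP.
Qed.

Lemma minimal_zs_size s : 0 \notin s -> minimal_zs s -> (2 <= size s)%N.
Proof.
case: s => [|x [|y s]] //; first by move=> _ [].
rewrite inE eq_sym => x0 [_ /= /eqP]; rewrite addr0.
by rewrite (negPf x0).
Qed.

Lemma minimal_zs_opp s x :
  minimal_zs s -> x != 0 -> x \in s -> - x \in s -> x != - x -> size s = 2%N.
Proof.
move=> [_ _ dec_s] x0 xs nxs xnx.
have p : perm_eq s ([:: x; - x] ++ rem (- x) (rem x s)).
  apply: (perm_trans (perm_to_rem xs)); rewrite /= perm_cons perm_to_rem //.
  by have := nxs; rewrite (perm_mem (perm_to_rem xs)) inE eq_sym (negPf xnx).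
have [] // := dec_s _ _ p; first by rewrite /= addr0 subrr.
by move=> r0; rewrite (perm_size p) r0.
Qed.

End ZeroSumLists.

(** * The classes as vectors, and the minimal zero-sum sequences over them *)

Section Vectors.

(** Rank 2 is the plane of vectors with last coordinate 0, so a single search serves both ranks. *)
Definition vec : zmodType := (int * int * int)%type.
Definition mkvec (a b c : int) : vec := (a, b, c).

Definition pos3 : seq vec :=
  [:: mkvec 1 0 0; mkvec 0 1 0; mkvec 0 0 1; mkvec 1 1 0; mkvec 1 0 1;
      mkvec 0 1 1; mkvec 1 1 1].
Definition pos2 : seq vec := [:: mkvec 1 0 0; mkvec 0 1 0; mkvec 1 1 0].
Definition classes2 : seq vec := pos2 ++ [seq - x | x <- pos2].
Definition classes3 : seq vec := pos3 ++ [seq - x | x <- pos3].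

(** Witnesses of lengths 3, 4 and 5: [triangle] has the maximal length in rank 2, [pentagon] in rank
    3. *)
Definition triangle : seq vec :=
  [:: mkvec 1 0 0; mkvec 0 1 0; mkvec (-1) (-1) 0].
Definition square : seq vec :=
  [:: mkvec 1 0 0; mkvec 0 1 0; mkvec 0 0 1; mkvec (-1) (-1) (-1)].
Definition pentagon : seq vec :=
  [:: mkvec 1 1 0; mkvec 1 0 1; mkvec 0 1 1; mkvec (-1) (-1) (-1);
      mkvec (-1) (-1) (-1)].

(** Since [g] and [- g] are counted together, this parity is additive over products of atoms and
    vanishes on every pair of [x] and [- x]. *)
Definition odd_mult (g : vec) (s : seq vec) : bool :=
  odd (count (fun x => (x == g) || (x == - g)) s).

Definition two_ones : seq vec := [:: mkvec 1 1 0; mkvec 1 0 1; mkvec 0 1 1].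

(* The parity clauses say that, modulo 2 and up to signs, the sequences of
   length 5 all have support [two_ones], and that no sequence of length 3 does
   and none of length 4 has empty support. *)
Definition zs_profile (s : seq vec) : bool :=
  [&& (size s <= 5)%N,
      (size s == 5%N) ==> all (fun g => odd_mult g s == (g \in two_ones)) pos3,
      (size s == 4%N) ==> has (fun g => odd_mult g s) pos3,
      (size s == 3%N) ==> has (fun g => odd_mult g s != (g \in two_ones)) pos3,
      (size s == 2%N) ==> all (fun g => ~~ odd_mult g s) pos3
    & all (fun x : vec => x.2 == 0) s ==> (size s <= 3)%N &&
        ((size s == 3%N) ==>
           perm_eq s triangle || perm_eq s [seq - x | x <- triangle])].

Definition dot (x y : vec) : int :=
  x.1.1 * y.1.1 + x.1.2 * y.1.2 + x.2 * y.2.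

Lemma dotDl x y z : dot (x + y) z = dot x z + dot y z.
Proof.
case: x => [[a b] c]; case: y => [[a' b'] c']; case: z => [[a'' b''] c''].
by rewrite /dot /= !mulrDl [RHS]addrACA; congr (_ + _); rewrite addrACA.
Qed.

Lemma dot_gt0 x : x != 0 -> (0 < dot x x)%R.
Proof.
case: x => [[a b] c] x0; rewrite /dot /= lt0r.
rewrite !addr_ge0 ?andbT -?expr2 ?sqr_ge0 //.
rewrite !paddr_eq0 ?addr_ge0 ?sqr_ge0 // !sqrf_eq0.
by apply: contraNN x0 => /andP[/andP[/eqP-> /eqP->] /eqP->].
Qed.

Lemma perm_odd_mult g s t : perm_eq s t -> odd_mult g s = odd_mult g t.
Proof. by move=> st; rewrite /odd_mult (permP st). Qed.

Lemma perm_zs_profile s t : perm_eq s t -> zs_profile s = zs_profile t.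
Proof.
move=> st; rewrite /zs_profile (perm_size st) (perm_all _ st).
rewrite !(permPl st).
have E g : odd_mult g s = odd_mult g t by exact: perm_odd_mult.
congr [&& _, _ ==> _, _ ==> _, _ ==> _, _ ==> _ & _].
- by apply: eq_all => g; rewrite E.
- by apply: eq_has => g; rewrite E.
- by apply: eq_has => g; rewrite E.
- by apply: eq_all => g; rewrite E.
Qed.

(** The evaluation also certifies that the fuel 6 suffices, because running out of it would give
    [false]. *)
Lemma zs_search3 :
  all (fun g => zs_search dot classes3 zs_profile 6 [:: g] [:: g] (lsum [:: g]))
    classes3.
Proof. by vm_compute. Qed.

Lemma minimal_zs_profile s :
  minimal_zs s -> {subset s <= classes3} -> zs_profile s.
Proof.
move=> min_s sG; case: s min_s sG => [[]//|g s] min_s sG.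
have gG := sG _ (mem_head _ _).
apply: (zs_searchP dotDl dot_gt0 perm_zs_profile
         (allP zs_search3 _ gG) _ min_s sG (rest := s)) => //.
- by move=> y; rewrite inE => /eqP ->; exists [:: g], [::]; rewrite /= addr0.
- case: s min_s {sG} => // -[_ /= /eqP]; rewrite addr0 => /eqP g0.
  by rewrite g0 in gG.
Qed.

End Vectors.

(** * Multisets as sequences up to permutation *)

Section MultisetFacts.
Context (K : choiceType).
Implicit Types (A B C : multiset K) (s t : seq K).

Lemma perm_msetD A B : perm_eq (A + B : multiset K) (A ++ B).
Proof.
by apply/allP => p _ /=; apply/eqP; rewrite count_cat !count_mem_mset msetE2.
Qed.

Lemma size_msetD A B : size (A + B : multiset K) = (size A + size B)%N.
Proof. by rewrite (perm_size (perm_msetD A B)) size_cat. Qed.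

Lemma seq_mset_cat s t : seq_mset (s ++ t) = seq_mset s + seq_mset t.
Proof.
apply/msetP => p.
by rewrite [RHS]msetE2 !mset_seqE count_cat.
Qed.

Lemma mset_of_perm A s : perm_eq A s -> A = seq_mset s.
Proof. by move/eq_seq_msetP; rewrite seq_mset_id. Qed.

Lemma perm_mset A B : perm_eq A B -> A = B.
Proof. by move/mset_of_perm; rewrite seq_mset_id. Qed.

Lemma size_msetS A B : (A `<=` B)%mset -> (size A <= size B)%N.
Proof. by move/msetBDKC => <-; rewrite size_msetD leq_addr. Qed.

End MultisetFacts.

(** No injectivity of [f] is assumed: the permutation is given by a list of positions, which is then
    read in [s] itself. *)
Lemma perm_map_cat (T : eqType) (S : eqType) (f : T -> S) s s1 s2 :
  perm_eq [seq f x | x <- s] (s1 ++ s2) ->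
  exists t1 t2, [/\ perm_eq s (t1 ++ t2), map f t1 = s1 & map f t2 = s2].
Proof.
case: s => [|x0 s].
  by move/perm_size; case: s1 s2 => [|//] [|//]; exists [::], [::].
rewrite perm_sym => /(perm_iotaP (f x0)) [I pI E].
pose t := [seq nth x0 (x0 :: s) i | i <- I].
have mt : map f t = s1 ++ s2.
  rewrite E -map_comp; apply/eq_in_map => i; rewrite (perm_mem pI) size_map.
  by rewrite mem_iota => /andP[_ i_lt]; rewrite /= -map_cons (nth_map x0).
exists (take (size s1) t), (drop (size s1) t).
rewrite cat_take_drop map_take map_drop mt take_size_cat ?drop_size_cat //.
split=> //; rewrite perm_sym; apply/(perm_iotaP x0).
by exists I; rewrite // -(size_map f).
Qed.

(** * Factorizations as zero-sum decompositions *)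

(* [psi] identifies the reduced monoid with the monoid of multisets over [P]
   whose image under [cl] has sum zero. *)
Section Transfer.
Context (H : nmodType) (P : choiceType) (V : zmodType).
Context (psi : reduced_monoid H -> multiset P) (cl : P -> V).
Hypothesis psiD : forall x y, psi (x + y) = psi x + psi y.
Hypothesis psi_inj : injective psi.
Hypothesis psi_zs : forall x, lsum [seq cl p | p <- psi x] = 0.
Hypothesis psi_onto :
  forall A : multiset P, lsum [seq cl p | p <- A] = 0 -> exists x, psi x = A.

Local Notation ratom := (red_atom H).
Implicit Types (x y : reduced_monoid H) (u v : ratom) (us vs ws : seq ratom).

Definition msize u : nat := size (psi (val u)).
Definition pr us : reduced_monoid H := \sum_(u <- us) val u.
Definition supp us : seq P := flatten [seq (psi (val u) : seq P) | u <- us].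

Lemma perm_psiD x y : perm_eq (psi (x + y)) (psi x ++ psi y).
Proof. by rewrite psiD; apply: perm_msetD. Qed.

Lemma psi_seq (A : seq P) :
  lsum [seq cl p | p <- A] = 0 -> exists x, perm_eq (psi x) A.
Proof.
move=> sumA; have [|x psix] := psi_onto (A := seq_mset A).
  by rewrite (perm_lsum (perm_map cl (perm_eq_seq_mset A))).
by exists x; rewrite psix perm_eq_seq_mset.
Qed.

Lemma psi_injp x y : perm_eq (psi x) (psi y) -> x = y.
Proof. by move=> /perm_mset/psi_inj. Qed.

Lemma size_psiD x y : size (psi (x + y)) = (size (psi x) + size (psi y))%N.
Proof. by rewrite psiD; apply: size_msetD. Qed.

Lemma psi0 : size (psi 0) = 0%N.
Proof.
by have := size_psiD 0 0; rewrite addr0; lia.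
Qed.

Lemma size_psi_eq0 x : size (psi x) = 0%N -> x = 0.
Proof. by move=> sx; apply: psi_injp; rewrite (size0nil sx) (size0nil psi0). Qed.

Lemma invertible_psi x : invertible x <-> x = 0.
Proof.
split=> [[y xy]|->]; last by exists 0; rewrite addr0.
by apply: size_psi_eq0; have := size_psiD x y; rewrite xy psi0; lia.
Qed.

(** What remains of a zero-sum multiset after removal of a zero-sum part has sum zero, hence comes
    from an element: divisibility amounts to inclusion of multisets. *)
Lemma psi_divides x y (B : seq P) :
  perm_eq (psi x) (psi y ++ B) -> exists2 z, x = y + z & perm_eq (psi z) B.
Proof.
move=> p; have [|z zB] := psi_seq (A := B).
  have := psi_zs x; rewrite (perm_lsum (perm_map cl p)) map_cat lsum_cat.
  by rewrite psi_zs add0r.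
exists z => //; apply: psi_injp; apply: perm_trans p _.
by rewrite perm_sym; apply: perm_trans (perm_psiD _ _) _; rewrite perm_cat2l.
Qed.

(** A zero-sum part of [psi x] and its complement both come from elements, so decompositions of [x]
    correspond to splittings of [psi x] into two zero-sum parts. *)
Lemma atom_minimal x : atom x <-> minimal_zs [seq cl p | p <- psi x].
Proof.
split=> [[ninv dec_x]|[s0 _ dec_s]].
- split=> //.
    apply/eqP => /(congr1 size); rewrite size_map => /size_psi_eq0 x0.
    by apply: ninv; apply/invertible_psi.
  move=> s1 s2 /perm_map_cat[A1 [A2 [p <- <-]]] sum1.
  have [y1 y1A] := psi_seq sum1.
  have [|y2 xy y2A] := @psi_divides x y1 A2.
    by apply: perm_trans p _; rewrite perm_cat2r perm_sym.
  case: (dec_x _ _ xy) => /invertible_psi y0; [left|right];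
    apply/size0nil; rewrite size_map.
    by rewrite -(perm_size y1A) y0 psi0.
  by rewrite -(perm_size y2A) y0 psi0.
- split=> [/invertible_psi x0|a b xab].
    by rewrite x0 (size0nil psi0) in s0.
  have /(perm_map cl) := perm_psiD a b; rewrite -xab map_cat => /dec_s.
  have nilP c : [seq cl p | p <- psi c] = [::] -> invertible c.
    move/(congr1 size); rewrite size_map => /size_psi_eq0 c0.
    by apply/invertible_psi.
  by rewrite psi_zs => /(_ erefl) [] /nilP ?; [left|right].
Qed.

Lemma ratom_minimal u : minimal_zs [seq cl p | p <- psi (val u)].
Proof. by apply/atom_minimal/asboolP/(valP u). Qed.

Lemma ratom_of (A : seq P) :
  minimal_zs [seq cl p | p <- A] -> exists u, perm_eq (psi (val u)) A.
Proof.
move=> minA; have [_ sumA _] := minA; have [x xA] := psi_seq sumA.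
have atx : `[< atom x >].
  apply/asboolP/atom_minimal; apply: perm_minimal_zs minA.
  by rewrite perm_sym perm_map.
by exists (Sub x atx); rewrite SubK.
Qed.

Lemma pr_cat us vs : pr (us ++ vs) = pr us + pr vs.
Proof. by rewrite /pr big_cat. Qed.

Lemma pr_cons u vs : pr (u :: vs) = val u + pr vs.
Proof. by rewrite /pr big_cons. Qed.

Lemma perm_pr us vs : perm_eq us vs -> pr us = pr vs.
Proof. exact: perm_big. Qed.

Lemma supp_cat us vs : supp (us ++ vs) = supp us ++ supp vs.
Proof. by rewrite /supp map_cat flatten_cat. Qed.

Lemma perm_psi_pr us : perm_eq (psi (pr us)) (supp us).
Proof.
elim: us => [|u us IH]; first by rewrite /pr big_nil (size0nil psi0).
rewrite pr_cons; apply: perm_trans (perm_psiD _ _) _.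
by rewrite /supp /= perm_cat2l.
Qed.

Lemma perm_supp us vs : perm_eq us vs -> perm_eq (supp us) (supp vs).
Proof.
move=> p; apply: perm_trans (perm_psi_pr vs); rewrite perm_sym -(perm_pr p).
exact: perm_psi_pr.
Qed.

Lemma size_supp us : size (supp us) = (\sum_(u <- us) msize u)%N.
Proof.
by elim: us => [|u us IH]; rewrite ?big_nil // big_cons -IH /supp /= size_cat.
Qed.

Lemma factorization_exists x : exists us, pr us = x.
Proof.
have [n] := ubnP (size (psi x)); elim: n x => // n IH x.
case: (pselect (atom x)) => [atx _|natx].
  have a' : `[< atom x >] by apply/asboolP.
  by exists [:: Sub x a' : ratom]; rewrite pr_cons /pr big_nil addr0.
case: (pselect (x = 0)) => [-> _|x0]; first by exists [::]; rewrite /pr big_nil.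
rewrite ltnS => xn.
have [a [b [xab a0 b0]]] : exists a b, [/\ x = a + b, a <> 0 & b <> 0].
  apply: contrapT => nab; apply: natx; split; first by move/invertible_psi.
  move=> a b xab; case: (pselect (a = 0)) => [a0|a0].
    by left; apply/invertible_psi.
  right; apply/invertible_psi; apply: contrapT => b0.
  by apply: nab; exists a, b.
have := size_psiD a b; rewrite -xab => sx.
have sz c : c <> 0 -> (0 < size (psi c))%N.
  by rewrite lt0n => c0; apply/eqP => /size_psi_eq0.
have [|us usa] := IH a; first by have := sz _ b0; lia.
have [|vs vsb] := IH b; first by have := sz _ a0; lia.
by exists (us ++ vs); rewrite pr_cat usa vsb xab.
Qed.

(** Going through [A], a factor is added only when the multiplicity of the current prime is not yet
    reached, and then one that contains this prime. So each element of [A] costs at most one factor,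
    and each factor meets [A]. *)
Lemma cover us (A : seq P) :
  (forall p, (count_mem p A <= count_mem p (supp us))%N) ->
  exists vs ws, [/\ perm_eq us (vs ++ ws), (size vs <= size A)%N,
    (forall v, v \in vs -> exists2 p, p \in A & p \in psi (val v))
    & forall p, (count_mem p A <= count_mem p (supp vs))%N].
Proof.
elim: A => [|p A IH] leA; first by exists [::], us.
have [|vs [ws [p_us svs meet leA']]] := IH.
  by move=> q; apply: leq_trans (leA q); rewrite /= leq_addl.
have [le_p|lt_p] := leqP (count_mem p (p :: A)) (count_mem p (supp vs)).
  exists vs, ws; split=> //; first by rewrite ltnW.
    by move=> v /meet[q qA]; exists q; rewrite // inE qA orbT.
  move=> q; case: (eqVneq p q) => [<- //|pq].
  by rewrite /= (negPf pq) add0n; apply: leA'.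
have : p \in supp ws.
  rewrite -has_pred1 has_count; have := leA p.
  by rewrite (permP (perm_supp p_us)) supp_cat count_cat; lia.
case/flattenP => _ /mapP[v vws ->] pv.
exists (v :: vs), (rem v ws); split=> //.
- apply: perm_trans p_us _; rewrite cat_cons -cat1s perm_sym perm_catCA.
  by rewrite perm_cat2l perm_sym perm_to_rem.
- move=> w; rewrite inE => /orP[/eqP->|/meet[q qA qw]].
    by exists p; rewrite ?mem_head.
  by exists q; rewrite // inE qA orbT.
- move=> q; rewrite [supp _]/(psi (val v) ++ supp vs) count_cat /=.
  apply: leq_add; last exact: leA'.
  by case: eqP => // <-; rewrite -has_count has_pred1.
Qed.

Lemma extract us u x :
  pr us = val u + x ->
  exists vs ws ys, [/\ perm_eq us (vs ++ ws), pr vs = val u + pr ys,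
    (size vs <= msize u)%N
    & forall v, v \in vs -> exists2 p, p \in psi (val u) & p \in psi (val v)].
Proof.
move=> us_ux.
have [|vs [ws [p svs meet le_vs]]] := @cover us (psi (val u)).
  move=> p; rewrite -(permP (perm_psi_pr us)) us_ux.
  by rewrite (permP (perm_psiD _ _)) count_cat leq_addr.
have /count_subseqP[t /perm_to_subseq[B vsB] ut] := le_vs.
have [|z vs_uz _] := @psi_divides (pr vs) (val u) B.
  apply: perm_trans (perm_psi_pr vs) _; apply: perm_trans vsB _.
  by rewrite perm_cat2r perm_sym.
have [ys ysz] := factorization_exists z.
by exists vs, ws, ys; rewrite ysz.
Qed.

(** Membership of [l] in the union of sets of lengths for [k], apart from the convention for groups.
    In this form concatenation of factorizations makes the relation additive. *)
Definition same_product k l : Prop :=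
  exists us vs, [/\ size us = k, size vs = l & pr us = pr vs].

Lemma same_productC k l : same_product k l -> same_product l k.
Proof. by move=> [us [vs [? ? ?]]]; exists vs, us. Qed.

Lemma same_productD k l k' l' :
  same_product k l -> same_product k' l' -> same_product (k + k') (l + l').
Proof.
move=> [us [vs [<- <- e]]] [us' [vs' [<- <- e']]].
by exists (us ++ us'), (vs ++ vs'); rewrite !size_cat !pr_cat e e'.
Qed.

Lemma same_product_refl k u : same_product k k.
Proof. by exists (nseq k u), (nseq k u); rewrite size_nseq. Qed.

Lemma fact_prod_seq us : Defs.fact_prod (seq_mset us) = pr us.
Proof. by rewrite /Defs.fact_prod /pr; apply/perm_big/perm_eq_seq_mset. Qed.

Lemma size_seq_mset us : size (seq_mset us) = size us.
Proof. by rewrite (perm_size (perm_eq_seq_mset us)). Qed.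

(** The atom [u] absorbs the convention for groups: there [l = k], and [k] copies of [u] on both
    sides witness the relation. *)
Lemma unions_of_lengthsE k l u :
  unions_of_lengths H k l <-> same_product k l.
Proof.
split=> [[[_ ->]|[a [[z zk <-] [z' z'k <-]]]]|[us [vs [<- <- e]]]].
- exact: same_product_refl.
- exists z, z'; split=> //.
  by rewrite -[pr z]/(Defs.fact_prod z) zk -[pr z']/(Defs.fact_prod z') z'k.
- right; exists (repr (pr us)); have E : coset (repr (pr us)) = pr us.
    exact: reprK.
  split; [exists (seq_mset us)|exists (seq_mset vs)];
    by rewrite ?size_seq_mset //= /factorizations E /factorizations_red /=
       fact_prod_seq.
Qed.

(** * Chains of factorizations *)

Section Chains.
Variables (x : reduced_monoid H) (N : nat).
Implicit Types z : multiset ratom.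

(** The relation [chain_connected] over an element of the reduced monoid, so that an induction can
    pass to a cofactor. *)
Definition linked z z' : Prop :=
  exists s : seq (multiset ratom),
    [/\ path (fun w w' => (fact_dist w w' <= N)%N) z s, last z s = z'
      & forall w, w \in s -> factorizations_red x w].

Lemma linked_refl z : linked z z.
Proof. by exists [::]. Qed.

Lemma linked_step z z' :
  factorizations_red x z' -> (fact_dist z z' <= N)%N -> linked z z'.
Proof.
move=> fz' d; exists [:: z']; rewrite /= d; split=> // y.
by rewrite inE => /eqP ->.
Qed.

Lemma linked_trans z2 z1 z3 : linked z1 z2 -> linked z2 z3 -> linked z1 z3.
Proof.
move=> [s [ps <- fs]] [t [pt <- ft]]; exists (s ++ t).
rewrite cat_path ps pt last_cat; split=> // y.
by rewrite mem_cat => /orP[/fs|/ft].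
Qed.

End Chains.

Lemma fact_distC (z z' : multiset ratom) : fact_dist z z' = fact_dist z' z.
Proof. by rewrite /fact_dist maxnC msetIC. Qed.

Lemma fact_distD (z z' w : multiset ratom) :
  fact_dist (z + w) (z' + w) = fact_dist z z'.
Proof. by rewrite /fact_dist -msetDIl !msetBDr. Qed.

Lemma fact_dist_le (z z' : multiset ratom) :
  (fact_dist z z' <= maxn (size z) (size z'))%N.
Proof.
rewrite /fact_dist geq_max !leq_max; apply/andP.
by split; apply/orP; [left|right]; apply/size_msetS/msubsetDl.
Qed.

Lemma linkedD x N (z z' w : multiset ratom) :
  linked x N z z' -> linked (x + Defs.fact_prod w) N (z + w) (z' + w).
Proof.
move=> [s [ps <- fs]]; exists [seq z1 + w | z1 <- s]; split.
- elim: s z ps {fs} => //= y s IH z /andP[d /IH ->].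
  by rewrite fact_distD d.
- by rewrite -(last_map (fun z1 => z1 + w)).
- move=> _ /mapP[y /fs fy ->]; rewrite /factorizations_red /=.
  rewrite /Defs.fact_prod (perm_big _ (perm_msetD _ _)) big_cat /=.
  by rewrite -[in RHS]fy.
Qed.

Lemma msize_minimal u : msize u = size [seq cl p | p <- psi (val u)].
Proof. by rewrite size_map. Qed.

Lemma supp_ge n us :
  (forall u, u \in us -> (n <= msize u)%N) -> (n * size us <= size (supp us))%N.
Proof.
move=> le_n; rewrite size_supp -sum1_size big_distrr /= !big_seq.
by apply: leq_sum => u /le_n; rewrite muln1.
Qed.

Lemma supp_le n us :
  (forall u, u \in us -> (msize u <= n)%N) -> (size (supp us) <= n * size us)%N.
Proof.
move=> le_n; rewrite size_supp -sum1_size big_distrr /= !big_seq.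
by apply: leq_sum => u /le_n; rewrite muln1.
Qed.

Lemma size_psi_pr us : size (psi (pr us)) = size (supp us).
Proof. exact: (perm_size (perm_psi_pr us)). Qed.

Lemma mem_divides u us : u \in us -> exists x, pr us = val u + x.
Proof.
by move=> /perm_to_rem /perm_pr ->; rewrite pr_cons; exists (pr (rem u us)).
Qed.

(** * The upper bound for the catenary degree *)

Section Bounds.
Variables (G : seq V) (D : nat).
Hypothesis clG : forall p, cl p \in G.
Hypothesis G0 : 0 \notin G.
Hypothesis Dmax :
  forall s, minimal_zs s -> {subset s <= G} -> (size s <= D)%N.

Lemma subset_cl (A : seq P) : {subset [seq cl p | p <- A] <= G}.
Proof. by move=> _ /mapP[p _ ->]. Qed.

Lemma msize_ge2 u : (2 <= msize u)%N.
Proof.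
rewrite msize_minimal; apply: minimal_zs_size (ratom_minimal u).
by apply: contra G0 => /subset_cl.
Qed.

Lemma msize_leD u : (msize u <= D)%N.
Proof. by rewrite msize_minimal; apply/Dmax/subset_cl/ratom_minimal. Qed.

Lemma step_to_atom u x (z : multiset ratom) :
  (exists y, x = val u + y) ->
  (forall v, (exists y, x = val v + y) -> (msize u <= msize v)%N) ->
  factorizations_red x z ->
  exists w : multiset ratom,
    x = val u + Defs.fact_prod w /\
    (fact_dist z (seq_mset [:: u] + w)%R <= D)%N.
Proof.
move=> [y xuy] min_u zx.
have zuy : pr z = val u + y by rewrite -xuy -zx.
have [vs [ws [ys [p vs_uys size_vs _]]]] := extract zuy.
have x_split : x = val u + (pr ys + pr ws).
  by rewrite addrA -vs_uys -pr_cat -(perm_pr p) -zx.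
exists (seq_mset (ys ++ ws)); split.
  by rewrite fact_prod_seq pr_cat -x_split.
rewrite (mset_of_perm p) !seq_mset_cat addrA -(seq_mset_cat [:: u] ys) fact_distD.
apply: leq_trans (fact_dist_le _ _) _; rewrite !size_seq_mset geq_max /=.
have u2 := msize_ge2 u.
rewrite (leq_trans size_vs (msize_leD u)) /=.
(* Counting primes, [msize u * size ys] is at most [D * size vs - msize u], hence at most
   [(D - 1) * msize u]. So [u] together with [ys] makes at most [D] atoms. *)
have ge_ys : (msize u * size ys <= size (supp ys))%N.
  apply: supp_ge => v /mem_divides[t yst]; apply: min_u; exists (val u + t + pr ws).
  by rewrite x_split yst !addrA [val u + val v]addrC.
have le_vs : (size (supp vs) <= D * size vs)%N.
  by apply: supp_le => v _; apply: msize_leD.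
have : size (supp vs) = (msize u + size (supp ys))%N.
  by rewrite -!size_psi_pr vs_uys size_psiD.
have := leq_mul (leqnn D) size_vs.
move: u2 ge_ys le_vs => *; nia.
Qed.

Lemma linked_bound x (z z' : multiset ratom) :
  factorizations_red x z -> factorizations_red x z' -> linked x D z z'.
Proof.
have [n] := ubnP (size (psi x)); elim: n x z z' => // n IH x z z' xn zx z'x.
case: (pselect (exists u y, x = val u + y)) => [[u0 ux0]|nou]; last first.
  have nil (w : multiset ratom) : factorizations_red x w -> w = mset0.
    move=> wx; apply/eqP; rewrite -size_mset_eq0 size_eq0.
    apply/eqP; case E : (w : seq ratom) => [//|u us]; case: nou.
    have [|y xy] := @mem_divides u (w : seq ratom); first by rewrite E mem_head.
    by exists u, y; rewrite -wx.
  by rewrite (nil _ zx) (nil _ z'x); apply: linked_refl.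
pose Q m := `[< exists u, (exists y, x = val u + y) /\ msize u = m >].
have exQ : exists m, Q m by exists (msize u0); apply/asboolP; exists u0.
case: (ex_minnP exQ) => m /asboolP[u [ux um]] min_m.
have min_u v : (exists y, x = val v + y) -> (msize u <= msize v)%N.
  by move=> vx; rewrite um; apply: min_m; apply/asboolP; exists v.
have [w [xw dw]] := step_to_atom ux min_u zx.
have [w' [xw' dw']] := step_to_atom ux min_u z'x.
have uwx (t : multiset ratom) : x = val u + Defs.fact_prod t ->
    factorizations_red x (seq_mset [:: u] + t).
  move=> ->; rewrite /factorizations_red /= /Defs.fact_prod.
  rewrite (perm_big _ (perm_msetD _ _)) big_cat /=.
  by rewrite (perm_big _ (perm_eq_seq_mset _)) big_seq1.
apply: linked_trans (linked_step (uwx _ xw) dw) _.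
apply: (@linked_trans _ _ (seq_mset [:: u] + w')); last first.
  by apply: linked_step; rewrite // fact_distC.
have ww' : Defs.fact_prod w' = Defs.fact_prod w.
  apply: psi_injp; rewrite -(perm_cat2l (psi (val u))).
  apply: perm_trans (perm_psiD _ _); rewrite -xw xw' perm_sym.
  exact: perm_psiD.
have := @linkedD (Defs.fact_prod w) D w w' (seq_mset [:: u]).
rewrite fact_prod_seq pr_cons /pr big_nil addr0 addrC -xw ![_ + seq_mset _]addrC.
apply; apply: IH => //.
have := size_psiD (val u) (Defs.fact_prod w); rewrite -xw.
by have := msize_ge2 u; rewrite /msize; lia.
Qed.

Lemma catenary_at_le (a : H) : le_enat (catenary_degree_at a) (Some D).
Proof. by apply: least_le => z z' za z'a; apply: linked_bound. Qed.

(** * Lifting sequences over [G] to atoms, by means of one chosen prime [pp g] in each class [g] *)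

Variable pp : V -> P.
Hypothesis ppK : {in G, cancel pp cl}.
Hypothesis oppG : forall g, g \in G -> - g \in G.

Lemma cl_map_pp s : {subset s <= G} -> [seq cl p | p <- map pp s] = s.
Proof.
move=> sG; rewrite -map_comp -[RHS]map_id; apply/eq_in_map => g /sG.
exact: ppK.
Qed.

Lemma subset_opp s : {subset s <= G} -> {subset [seq - g | g <- s] <= G}.
Proof. by move=> sG _ /mapP[g /sG/oppG gG ->]. Qed.

Lemma list_atom s :
  minimal_zs s -> {subset s <= G} ->
  exists u, perm_eq (psi (val u)) (map pp s).
Proof. by move=> min_s sG; apply: ratom_of; rewrite cl_map_pp. Qed.

Lemma pair_atoms s :
  {subset s <= G} ->
  exists us, [/\ size us = size s,
    perm_eq (supp us) (map pp s ++ map pp [seq - g | g <- s])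
    & forall u, u \in us ->
        exists2 g, g \in s & perm_eq (psi (val u)) [:: pp g; pp (- g)]].
Proof.
elim: s => [|g s IH] sG; first by exists [::].
have gG : g \in G by apply: sG; rewrite mem_head.
have [|us [sus pus eus]] := IH.
  by move=> h hs; apply: sG; rewrite inE hs orbT.
have [||u up] := @list_atom [:: g; - g].
- by apply: minimal_zs_pair; apply: contraNneq G0 => <-.
- by move=> h; rewrite !inE => /orP[/eqP->|/eqP->] //; apply: oppG.
exists (u :: us); split; rewrite /= ?sus //.
- rewrite [supp _]/(psi (val u) ++ supp us).
  apply: perm_trans (perm_cat up pus) _.
  rewrite /= perm_cons -cat1s perm_sym -[X in _ ++ X]cat1s.
  by rewrite perm_catCA.
- move=> v; rewrite inE => /orP[/eqP->|/eus[h hs p]].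
    by exists g; rewrite ?mem_head.
  by exists h; rewrite // inE hs orbT.
Qed.

(** The primes lying over [s] and over its negative can be regrouped into pairs over [g] and
    [- g]. *)
Lemma two_factorizations s :
  minimal_zs s -> {subset s <= G} ->
  exists u v us, [/\ perm_eq (psi (val u)) (map pp s),
    perm_eq (psi (val v)) (map pp [seq - g | g <- s]),
    pr us = pr [:: u; v], size us = size s
    & forall w, w \in us ->
        exists2 g, g \in s & perm_eq (psi (val w)) [:: pp g; pp (- g)]].
Proof.
move=> min_s sG; have [u pu] := list_atom min_s sG.
have [v pv] := list_atom (minimal_zsN min_s) (subset_opp sG).
have [us [sus pus eus]] := pair_atoms sG.
exists u, v, us; split=> //; apply: psi_injp.
apply: perm_trans (perm_psi_pr us) _; apply: perm_trans pus _.
rewrite perm_sym; apply: perm_trans (perm_psi_pr _) _.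
by rewrite /supp /= cats0; apply: perm_cat.
Qed.

Lemma same_product2 s :
  minimal_zs s -> {subset s <= G} -> same_product 2 (size s).
Proof.
move=> min_s sG; have [u [v [us [_ _ e sus _]]]] := two_factorizations min_s sG.
by exists [:: u; v], us; rewrite sus e.
Qed.

(** * Unions of sets of lengths and elasticities *)

Definition max_length k := (D * k./2 + odd k)%N.

Section Lengths.
Hypothesis zs_lengths : forall d, (2 <= d <= D)%N ->
  exists2 s, minimal_zs s & {subset s <= G} /\ size s = d.
Hypothesis D2 : (2 <= D)%N.
Hypothesis length_bound :
  forall us vs, pr us = pr vs -> (size vs <= max_length (size us))%N.

(** The excess [t] is distributed greedily over [m] products of the form U(-U): each replaces two
    atoms by [d.+2], where [d] may be anything up to [D - 2]. *)
Lemma same_product_even m t :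
  (t <= m * (D - 2))%N -> same_product (2 * m) (2 * m + t).
Proof.
elim: m t => [|m IH] t; rewrite ?[(_.+1 * (D - 2))%N]mulSn => tm.
  by exists [::], [::]; split=> //=; lia.
have [d dE] : exists d, d = minn t (D - 2) by exists (minn t (D - 2)).
have [|s min_s [sG sd]] := zs_lengths (d := d.+2); first by lia.
have [|us [vs [su sv e]]] := IH (t - d)%N; first by move: (m * _)%N tm => q; lia.
have := same_productD (same_product2 min_s sG)
          (ex_intro _ us (ex_intro _ vs (And3 su sv e))).
rewrite sd mulnS.
by have -> // : (d.+2 + (2 * m + (t - d)) = 2 + 2 * m + t)%N by lia.
Qed.

Lemma same_product_up k l :
  (k <= l <= max_length k)%N -> same_product k l.
Proof.
rewrite /max_length => kl.
(* This provides an atom [u] to be put on both sides when [k] is odd. *)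
have [|s min_s [sG _]] := zs_lengths (d := 2); first by lia.
have [u _] := list_atom min_s sG.
have kE := odd_double_half k.
have := same_productD (same_product_refl (odd k) u)
  (@same_product_even k./2 (l - k) _).
have -> : (odd k + 2 * k./2 = k)%N by lia.
have -> : (odd k + (2 * k./2 + (l - k)) = l)%N by lia.
by apply; nia.
Qed.

Lemma unions_of_lengths_iff k l :
  unions_of_lengths H k l <-> (l <= max_length k)%N && (k <= max_length l)%N.
Proof.
have [|s min_s [sG _]] := zs_lengths (d := 2); first by lia.
have [u _] := list_atom min_s sG.
apply: (iff_trans (unions_of_lengthsE k l u)); split.
  move=> [us [vs [<- <- e]]].
  by rewrite !length_bound.
move=> /andP[lk kl]; have [le_kl|/ltnW le_lk] := leqP k l.
  by apply: same_product_up; rewrite le_kl.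
by apply/same_productC/same_product_up; rewrite le_lk.
Qed.

Lemma max_length_homo k l : (k <= l)%N -> (max_length k <= max_length l)%N.
Proof.
move=> kl; rewrite /max_length.
have := odd_double_half k; have := odd_double_half l.
case: (ltnP k./2 l./2) => [lt_kl|le_lk].
  have := leq_mul (leqnn D) lt_kl; rewrite mulnS; case: (odd k); lia.
have -> : k./2 = l./2 by have := half_leq kl; lia.
lia.
Qed.

(** Of the two inequalities describing the lengths, one passes to smaller lengths and the other, as
    [max_length] is monotone, to larger ones. *)
Lemma unions_of_lengths_interval k : nat_interval (unions_of_lengths H k).
Proof.
move=> l m n /unions_of_lengths_iff/andP[_ kl] /unions_of_lengths_iff/andP[nk _].
move=> /andP[lm mn]; apply/unions_of_lengths_iff.
by rewrite (leq_trans mn nk) (leq_trans kl (max_length_homo lm)).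
Qed.

Lemma elasticityE k : elasticity H k = Some (max_length k).
Proof.
have le_max n : (n <= max_length n)%N.
  by have := odd_double_half n; rewrite /max_length; nia.
apply: enat_sup_max.
  exists (max_length k) => //; apply/unions_of_lengths_iff.
  by rewrite leqnn (leq_trans (le_max k) (le_max _)).
by move=> _ [l /unions_of_lengths_iff/andP[lk _] <-].
Qed.

End Lengths.

(** * The exact value of the catenary degree *)

Lemma pr_ratom ys v : pr ys = val v -> ys = [:: v].
Proof.
case: ys => [|w ws].
  rewrite /pr big_nil => v0; have := msize_ge2 v.
  by rewrite /msize -v0 psi0.
rewrite pr_cons => wv.
have [_ /(_ _ _ (esym wv))] : atom (val v) by apply/asboolP/(valP v).
case=> /invertible_psi e0.
  by have := msize_ge2 w; rewrite /msize e0 psi0.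
have := size_psi_pr ws; rewrite e0 psi0 addr0 in wv *.
have -> : ws = [::].
  case: ws => // a ws in e0 *.
  have := size_psi_pr (a :: ws); rewrite e0 psi0 [supp _]/(psi (val a) ++ _).
  by rewrite size_cat; have := msize_ge2 a; rewrite /msize; lia.
by move=> _; rewrite (val_inj wv).
Qed.

Lemma pr_addrI u x y : val u + x = val u + y -> x = y.
Proof.
move=> e; apply: psi_injp; rewrite -(perm_cat2l (psi (val u))).
apply: perm_trans (perm_psiD _ _); rewrite -e perm_sym.
exact: perm_psiD.
Qed.

(** Let [u] and [v] lie over [s] and its negative. By the last hypothesis a factorization of their
    product is either [[:: u; v]] or consists of [D] atoms of length 2. The latter kind shares no
    atom with [[:: u; v]], so a chain between the two kinds has a step of size at least [D]. *)
Lemma catenary_degreeE s :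
  minimal_zs s -> {subset s <= G} -> size s = D -> (3 <= D)%N ->
  (forall t r, minimal_zs t -> perm_eq (s ++ [seq - g | g <- s]) (t ++ r) ->
     [\/ size t = 2, perm_eq t s | perm_eq t [seq - g | g <- s]]) ->
  catenary_degree H = Some D.
Proof.
move=> min_s sG sD D3 only2.
have [u [v [us [pu pv e sus eus]]]] := two_factorizations min_s sG.
have only_two (y : multiset ratom) : factorizations (repr (pr us)) y ->
    y = seq_mset [:: u; v] \/ [/\ size y = D, u \notin y & v \notin y].
  have E : coset (repr (pr us)) = pr us by exact: reprK.
  rewrite /factorizations E e => yE.
  have pryE : pr y = val u + val v.
    by rewrite -[LHS]/(Defs.fact_prod y) yE !pr_cons /pr big_nil addr0.
  have two w w' : pr y = val w + val w' -> w \in (y : seq ratom) ->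
      y = seq_mset [:: w; w'].
    move=> yww wy; apply: mset_of_perm; apply: perm_trans (perm_to_rem wy) _.
    have /pr_addrI/pr_ratom -> // : val w + pr (rem w y) = val w + val w'.
    by rewrite -pr_cons -(perm_pr (perm_to_rem wy)).
  case: (boolP (u \in (y : seq ratom))) => [/(two _ _ pryE)->|uy]; first by left.
  case: (boolP (v \in (y : seq ratom))) => [vy|vy].
    left; rewrite (two v u) 1?addrC //.
    by apply/eq_seq_msetP; rewrite (perm_catC [:: v] [:: u]).
  right; split=> //.
  have sgnG : {subset s ++ [seq - g | g <- s] <= G}.
    by move=> g; rewrite mem_cat => /orP[/sG|/(subset_opp sG)].
  have py : perm_eq (supp y) (map pp (s ++ [seq - g | g <- s])).
    rewrite perm_sym map_cat; apply: perm_trans (perm_psi_pr y); rewrite pryE.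
    rewrite perm_sym; apply: perm_trans (perm_psiD _ _) _; exact: perm_cat.
  (* Only chosen primes occur in the product, so its atoms are determined by their classes, and
     [only2] speaks about the atoms themselves. *)
  have ppcl p : p \in supp y -> pp (cl p) = p.
    by rewrite (perm_mem py) => /mapP[g /sgnG gG ->]; rewrite ppK.
  have size2 w : w \in (y : seq ratom) -> msize w = 2%N.
    move=> wy; have pw : perm_eq (supp y) (psi (val w) ++ supp (rem w y)).
      exact: perm_supp (perm_to_rem wy).
    have ppw : map pp [seq cl p | p <- psi (val w)] = psi (val w).
      rewrite -map_comp -[RHS]map_id; apply/eq_in_map => p pw'.
      by apply: ppcl; rewrite (perm_mem pw) mem_cat pw'.
    have : perm_eq (s ++ [seq - g | g <- s])
        ([seq cl p | p <- psi (val w)] ++ [seq cl p | p <- supp (rem w y)]).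
      rewrite -map_cat -(cl_map_pp sgnG) perm_map //.
      by rewrite perm_sym in py; apply: perm_trans py pw.
    move=> /(only2 _ _ (ratom_minimal w)) [sw|pws|pws]; first by rewrite msize_minimal.
    - case/negP: uy; suff <- : w = u by [].
      apply/val_inj/psi_injp; rewrite -ppw.
      by apply: perm_trans (perm_map pp pws) _; rewrite perm_sym.
    - case/negP: vy; suff <- : w = v by [].
      apply/val_inj/psi_injp; rewrite -ppw.
      by apply: perm_trans (perm_map pp pws) _; rewrite perm_sym.
  have := @supp_ge 2 y; have := @supp_le 2 y; rewrite (perm_size py).
  rewrite size_map size_cat size_map sD => le2 ge2.
  have {}le2 : (D + D <= 2 * size y)%N := le2 (fun w wy => eq_leq (size2 w wy)).
  have {}ge2 : (2 * size y <= D + D)%N := ge2 (fun w wy => eq_leq (esym (size2 w wy))).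
  lia.
have at_x : le_enat (Some D) (catenary_degree_at (repr (pr us))).
  have E : coset (repr (pr us)) = pr us by exact: reprK.
  apply: least_ge => N chain; rewrite leqNgt; apply/negP => ND.
  have fus : factorizations (repr (pr us)) (seq_mset us).
    by rewrite /factorizations E /factorizations_red /= fact_prod_seq.
  have fuv : factorizations (repr (pr us)) (seq_mset [:: u; v]).
    by rewrite /factorizations E /factorizations_red /= fact_prod_seq e.
  have [t [pt lt ft]] := chain _ _ fuv fus.
  (* A chain with all steps below [D] cannot leave [[:: u; v]]. It would therefore end in length 2,
     whereas [us] has length [D], at least 3. *)
  have : last (seq_mset [:: u; v]) t = seq_mset [:: u; v].
    elim: t pt ft {lt} => //= y t IH /andP[dy pt] ft.
    have [yE|[sy uy vy]] := only_two y (ft y (mem_head _ _)).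
      rewrite yE in pt *; apply: IH => // w wt; apply: ft.
      by rewrite inE wt orbT.
    move: dy; rewrite leqNgt => /negP[]; apply: leq_trans ND _.
    rewrite /fact_dist.
    have -> : (seq_mset [:: u; v] `&` y = mset0)%mset.
      apply/msetP => w; rewrite msetE2 mset_seqE mset0E /=.
      case: (eqVneq u w) => [<-|_].
        by rewrite (mset_eq0P uy) minn0.
      by case: (eqVneq v w) => [<-|_]; rewrite ?(mset_eq0P vy) ?minn0 ?min0n.
    by rewrite !msetB0 sy leq_max leqnn orbT.
  rewrite lt => /(congr1 (fun z : multiset ratom => size z)).
  by rewrite /= !size_seq_mset sus sD /= => D2; rewrite D2 in D3.
apply: enat_sup_max => [|_ [a _ <-]]; last exact: catenary_at_le.
exists (repr (pr us)) => //.
have := catenary_at_le (repr (pr us)).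
case: (catenary_degree_at _) at_x => //= m; move=> *; congr Some; lia.
Qed.

(** * The tame degree when all atoms of length 3 are of type [T] or [- T] *)

Section Tame.
Variable T : seq V.
Hypothesis T_minimal : minimal_zs T.
Hypothesis TG : {subset T <= G}.
Hypothesis T_size : size T = 3%N.
Hypothesis T_opp : forall g, g \in T -> - g \notin T.
Hypothesis T_only : forall s, minimal_zs s -> {subset s <= G} ->
  size s = 3%N -> perm_eq s T \/ perm_eq s [seq - g | g <- T].
Hypothesis D3 : D = 3%N.

(** The class of a common prime decides between [T] and its negative, as these have no element in
    common. *)
Lemma triangle_atom_meet u v p :
  msize u = 3%N -> msize v = 3%N -> p \in psi (val u) -> p \in psi (val v) ->
  perm_eq [seq cl q | q <- psi (val u)] [seq cl q | q <- psi (val v)].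
Proof.
have T_opp' g : g \in T -> g \in [seq - h | h <- T] -> False.
  by move=> gT /mapP[h hT gh]; move: (T_opp hT); rewrite -gh gT.
rewrite !msize_minimal => su sv /(map_f cl) pu /(map_f cl) pv.
have [Eu|Eu] := T_only (ratom_minimal u) (@subset_cl _) su;
have [Ev|Ev] := T_only (ratom_minimal v) (@subset_cl _) sv;
  rewrite (perm_mem Eu) in pu; rewrite (perm_mem Ev) in pv;
  try by case: (T_opp' _ pu pv) || case: (T_opp' _ pv pu).
all: by apply: perm_trans Eu _; rewrite perm_sym.
Qed.

Lemma tame_extract u us x :
  pr us = val u + x ->
  exists vs ws ys, [/\ perm_eq us (vs ++ ws), pr vs = val u + pr ys
    & (maxn (size ys).+1 (size vs) <= 3)%N].
Proof.
move=> /extract[vs [ws [ys [p vs_uys size_vs meet]]]].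
exists vs, ws, ys; split=> //.
have u2 := msize_ge2 u; have u3 := msize_leD u.
have leS : (size (supp vs) <= 3 * size vs)%N.
  by apply: supp_le => v _; rewrite -D3; apply: msize_leD.
have geS : (2 * size ys <= size (supp ys))%N.
  by apply: supp_ge => v _; apply: msize_ge2.
have S : size (supp vs) = (msize u + size (supp ys))%N.
  by rewrite -!size_psi_pr vs_uys size_psiD.
rewrite geq_max; apply/andP; split; last by lia.
rewrite ltnNge; apply/negP => ys3.
(* With three or more atoms in [ys], the chain [msize u + 6 <= size (supp vs) <= 3 * size vs <= 3 *
   msize u <= 9] consists of equalities. *)
have [u3E vs3] : msize u = 3%N /\ size vs = 3%N by lia.
have v3 v : v \in vs -> msize v = 3%N.
  move=> vvs; apply/eqP; rewrite eqn_leq -{1}D3 msize_leD ltnNge.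
  apply/negP => v2; have pv := perm_to_rem vvs.
  have : (size (supp (rem v vs)) <= 3 * size (rem v vs))%N.
    by apply: supp_le => w _; rewrite -D3; apply: msize_leD.
  have sv : size (supp vs) = (msize v + size (supp (rem v vs)))%N.
    by rewrite (perm_size (perm_supp pv)) [supp (v :: _)]/(_ ++ _) size_cat.
  have := perm_size pv => /=; lia.
(* All factors in [vs] have length 3 and meet [u], so they have the type of [u] and contain no
   further classes. *)
have in_u g : g \in [seq cl p | p <- supp vs] ->
    g \in [seq cl p | p <- psi (val u)].
  move=> /mapP[q /flattenP[_ /mapP[v vvs ->] qv] ->].
  have [r ru rv] := meet _ vvs.
  by rewrite (perm_mem (triangle_atom_meet u3E (v3 _ vvs) ru rv)) map_f.
have vs_supp : perm_eq (supp vs) (psi (val u) ++ supp ys).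
  apply: perm_trans (_ : perm_eq _ (psi (pr vs))) _.
    by rewrite perm_sym perm_psi_pr.
  rewrite vs_uys; apply: perm_trans (perm_psiD _ _) _.
  by rewrite perm_cat2l perm_psi_pr.
(* An atom of length 2 in [ys] would put both [g] and [- g] among the classes of [u], which [T_opp]
   forbids. So [ys] needs at least 9 primes, but only 6 are left. *)
have {}geS : (3 * size ys <= size (supp ys))%N.
  apply: supp_ge => y yys; rewrite ltn_neqAle msize_ge2 andbT.
  apply/eqP => y2.
  have in_u' g : g \in [seq cl p | p <- psi (val y)] ->
      g \in [seq cl p | p <- psi (val u)].
    move=> /mapP[q qy ->]; apply/in_u/map_f.
    rewrite (perm_mem vs_supp) mem_cat; apply/orP; right.
    by apply/flattenP; exists (psi (val y) : seq P) => //; apply/mapP; exists y.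
  have [_ sum_y _] := ratom_minimal y.
  move: in_u' sum_y y2; rewrite msize_minimal.
  case: [seq cl p | p <- _] => [|g [|h []]] //= in_u' gh _.
  have hg : h = - g by apply/eqP; rewrite -addr_eq0 -[h]addr0 addrC gh.
  have := in_u' h; have := in_u' g; rewrite !inE !eqxx orbT hg.
  rewrite msize_minimal in u3E.
  have [Eu|Eu] := T_only (ratom_minimal u) (@subset_cl _) u3E;
    rewrite !(perm_mem Eu) => /(_ isT) gu /(_ isT).
    by rewrite (negPf (T_opp gu)).
  rewrite (mem_map (@oppr_inj _)) => gT; case/mapP: gu => k kT gk.
  by move: (T_opp kT); rewrite -gk gT.
by lia.
Qed.

Lemma tame_degree_at_le u : le_enat (tame_degree_at u) (Some 3%N).
Proof.
apply: least_le => a z [x aux] za _.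
have [|vs [ws [ys [p vs_uys max3]]]] := @tame_extract u z x.
  by rewrite -aux -za.
exists (seq_mset vs), (seq_mset ys); rewrite !fact_prod_seq !size_seq_mset.
split=> //; rewrite (mset_of_perm p); apply/msubsetP => v.
by rewrite !mset_seqE count_cat leq_addr.
Qed.

(** For the lower bound, take [u] over [T] and the factorization of T(-T) into pairs: each pair
    contains only one prime over [T], so three pairs are required to cover [u]. *)
Lemma tame_degreeE : tame_degree H = Some 3%N.
Proof.
have [u [v [us [pu pv e sus eus]]]] := two_factorizations T_minimal TG.
have at_u : le_enat (Some 3%N) (tame_degree_at u).
  apply: least_ge => N tameN.
  have [|||x [y [xus xuy maxN]]] := tameN (pr us) (seq_mset us).
  - by exists (val v); rewrite e !pr_cons /pr big_nil addr0.
  - exact: fact_prod_seq.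
  - apply/negP; rewrite (perm_mem (perm_eq_seq_mset us)) => /eus[g _ pg].
    by have := perm_size pg; rewrite (perm_size pu) size_map T_size.
  pose inT p := p \in map pp T.
  have one_T w : w \in (x : seq ratom) -> (count inT (psi (val w)) <= 1)%N.
    move=> /(msubset_subset xus).
    rewrite (perm_mem (perm_eq_seq_mset us)) => /eus[g gT /permP ->] /=.
    have -> : inT (pp (- g)) = false.
      apply/mapP => -[h hT ppgh].
      have := T_opp gT; have gG := TG gT; rewrite -(ppK (oppG gG)) ppgh.
      by rewrite (ppK (TG hT)) hT.
    by case: inT.
  have count_x : (count inT (supp x) <= size x)%N.
    elim: (x : seq ratom) one_T => // w ws IH one_T.
    rewrite [supp _]/(psi (val w) ++ supp ws) count_cat /=.
    rewrite -add1n leq_add ?one_T ?mem_head // IH // => w' w'ws.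
    by apply: one_T; rewrite inE w'ws orbT.
  have : (3 <= count inT (supp x))%N.
    rewrite -(permP (perm_psi_pr x)) -[pr x]/(Defs.fact_prod x) xuy.
    rewrite (permP (perm_psiD _ _)) count_cat (permP pu) -T_size -(size_map pp T).
    rewrite (_ : count _ (map pp T) = size (map pp T)) ?leq_addr //.
    by apply/eqP; rewrite -all_count; apply/allP.
  move=> x3; apply: leq_trans x3 (leq_trans count_x (leq_trans _ maxN)).
  exact: leq_maxr.
apply: enat_sup_max => [|_ [w _ <-]]; last exact: tame_degree_at_le.
exists u => //; have := tame_degree_at_le u.
case: (tame_degree_at u) at_u => //= m m3 m3'; congr Some.
by apply/eqP; rewrite eqn_leq m3 m3'.
Qed.

End Tame.

End Bounds.

End Transfer.

(** The condition is a finite computation over sublists. Its second alternative dismisses a list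
    with distinct entries [x] and [- x]: if minimal, it consists of these two. *)
Lemma only_opposite_atoms (s : seq vec) :
  all (fun t => (lsum t == 0) && (t != [::]) ==>
     [|| size t == 2%N, has (fun x => [&& x != 0, x != - x & - x \in t]) t,
         perm_eq t s | perm_eq t [seq - g | g <- s]])
    (subs (s ++ [seq - g | g <- s])) ->
  forall t r, minimal_zs t -> perm_eq (s ++ [seq - g | g <- s]) (t ++ r) ->
    [\/ size t = 2%N, perm_eq t s | perm_eq t [seq - g | g <- s]].
Proof.
move=> /allP all_t t r min_t /perm_cat_subs[t' t's tt'].
have min_t' := perm_minimal_zs tt' min_t; have [t0 sum_t _] := min_t'.
rewrite (perm_size tt') !(permPl tt').
have := all_t _ t's; rewrite sum_t eqxx t0 /=.
case/or4P => [/eqP ?|/hasP[x xt /and3P[x0 xnx nxt]]|?|?].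
- by apply: Or31.
- by apply: Or31; apply: minimal_zs_opp min_t' x0 xt nxt xnx.
- by apply: Or32.
- by apply: Or33.
Qed.

(** * Upper bounds for the lengths of factorizations *)

Lemma sum_le1 (I : eqType) (s : seq I) (f : I -> nat) :
  (\sum_(x <- s) f x <= 1)%N ->
  (forall x, x \in s -> f x = 0%N) \/
  exists x s', [/\ perm_eq s (x :: s'), f x = 1%N
    & forall y, y \in s' -> f y = 0%N].
Proof.
have sum0 (t : seq I) : (\sum_(x <- t) f x = 0)%N -> forall x, x \in t -> f x = 0%N.
  by move=> t0 x xt; move: t0; rewrite (big_rem x) //=; lia.
elim: s => [|x s IH]; first by left.
rewrite big_cons; case fx : (f x) => [|n] sum_s.
  have [fs|[y [s' [p fy fs']]]] := IH sum_s.
    by left=> y; rewrite inE => /orP[/eqP->|/fs].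
  right; exists y, (x :: s'); split=> // [|z].
    apply: perm_trans (_ : perm_eq _ (x :: y :: s')) _; first by rewrite perm_cons.
    by apply/permPl; apply: (perm_catCA [:: x] [:: y] s').
  by rewrite inE => /orP[/eqP->|/fs'].
right; exists x, s; split=> //; first by lia.
by apply: sum0; lia.
Qed.

Section LengthBounds.
Context (H : nmodType) (P : choiceType).
Context (psi : reduced_monoid H -> multiset P) (cl : P -> vec).
Hypothesis psiD : forall x y, psi (x + y) = psi x + psi y.
Hypothesis psi_inj : injective psi.
Hypothesis psi_zs : forall x, lsum [seq cl p | p <- psi x] = 0.
Hypothesis psi_onto :
  forall A : multiset P, lsum [seq cl p | p <- A] = 0 -> exists x, psi x = A.
Hypothesis clG : forall p, cl p \in classes3.

Local Notation ratom := (red_atom H).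
Local Notation msize := (msize psi).
Implicit Types (u v : ratom) (us vs : seq ratom).

Lemma ratom_profile u : zs_profile [seq cl p | p <- psi (val u)].
Proof.
apply: minimal_zs_profile; first exact: (ratom_minimal psiD psi_inj psi_zs psi_onto).
by move=> _ /mapP[p _ ->].
Qed.

Let parity g us : bool := odd_mult g [seq cl p | p <- supp psi us].

Lemma parity_cons g u us :
  parity g (u :: us) =
    odd_mult g [seq cl p | p <- psi (val u)] (+) parity g us.
Proof. by rewrite /parity /odd_mult /supp /= map_cat count_cat oddD. Qed.

Lemma perm_parity g us vs : perm_eq us vs -> parity g us = parity g vs.
Proof.
by move=> p; apply/perm_odd_mult/perm_map/perm_supp.
Qed.

Lemma parity_pr g us vs : pr us = pr vs -> parity g us = parity g vs.
Proof.
move=> e; apply/perm_odd_mult/perm_map.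
apply: perm_trans (perm_psi_pr psiD vs); rewrite -e perm_sym.
exact: perm_psi_pr.
Qed.

Lemma parity5 g us : g \in pos3 -> (forall u, u \in us -> msize u = 5%N) ->
  parity g us = odd (size us) && (g \in two_ones).
Proof.
move=> gpos; elim: us => // u us IH u5.
rewrite parity_cons IH => [|v vus]; last by apply: u5; rewrite inE vus orbT.
have /and5P[_ + _ _ _] := ratom_profile u.
rewrite size_map -/(msize u) u5 ?mem_head // => /allP /(_ _ gpos) /eqP ->.
by rewrite /=; case: (g \in _); case: odd.
Qed.

Lemma parity2 g us : g \in pos3 -> (forall u, u \in us -> msize u = 2%N) ->
  parity g us = false.
Proof.
move=> gpos; elim: us => // u us IH u2.
rewrite parity_cons IH => [|v vus]; last by apply: u2; rewrite inE vus orbT.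
have /and5P[_ _ _ _ /andP[+ _]] := ratom_profile u.
by rewrite size_map -/(msize u) u2 ?mem_head // => /allP /(_ _ gpos) /negPf ->.
Qed.

Lemma msize_bounds u : (2 <= msize u <= 5)%N.
Proof.
apply/andP; split.
  exact: (msize_ge2 psiD psi_inj psi_zs psi_onto clG).
by have /andP[] := ratom_profile u; rewrite size_map.
Qed.

(* If 2k+1 atoms equal at least 5k+2 atoms then, up to at most one exception in
   all, the former have length 5 and the latter length 2; comparing parities of
   multiplicities shows that the exception cannot compensate the difference. *)
Lemma length_bound5 us vs : pr us = pr vs ->
  (size vs <= max_length 5 (size us))%N.
Proof.
move=> e; rewrite leqNgt; apply/negP; rewrite /max_length => lt_vs.
have T : size (supp psi us) = size (supp psi vs).
  by rewrite -!(size_psi_pr psiD) e.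
(* Counting primes on both sides, the deficits from 5 in [us] and the excesses over 2 in [vs] add up
   to [5 * size us - 2 * size vs]. This would be negative for even [size us] and is at most 1 for
   odd [size us]. *)
have defs : (\sum_(u <- us) (5 - msize u) + size (supp psi us) = 5 * size us)%N.
  rewrite size_supp -big_split -sum1_size big_distrr /=.
  by apply: eq_bigr => u _; have := msize_bounds u; lia.
have excs : (\sum_(v <- vs) (msize v - 2) + 2 * size vs = size (supp psi vs))%N.
  rewrite size_supp -sum1_size big_distrr -big_split /=.
  by apply: eq_bigr => u _; have := msize_bounds u; lia.
have us_odd : odd (size us).
  apply/negPn/negP => /negPf ev; move: lt_vs; rewrite ev.
  by have := odd_double_half (size us); lia.
have small : (\sum_(u <- us) (5 - msize u) + \sum_(v <- vs) (msize v - 2) <= 1)%N.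
  by move: lt_vs; rewrite us_odd; have := odd_double_half (size us); lia.
have is5 u : (5 - msize u)%N = 0%N -> msize u = 5%N.
  by have := msize_bounds u; lia.
have is2 u : (msize u - 2)%N = 0%N -> msize u = 2%N.
  by have := msize_bounds u; lia.
have [us5|[u [us' [pus u4 us5]]]] := sum_le1 (leq_trans (leq_addr _ _) small).
  have Pus g : g \in pos3 -> parity g us = (g \in two_ones).
    by move=> gpos; rewrite parity5 ?us_odd // => u /us5/is5.
  have [vs2|[v [vs' [pvs v3 vs2]]]] := sum_le1 (leq_trans (leq_addl _ _) small).
    have := Pus (mkvec 1 1 0) isT; rewrite (parity_pr _ e) parity2 //.
    by move=> v /vs2/is2.
  (* The exception is [v], of length 3: it alone would have the parities of [two_ones], which its
     profile excludes. *)
  have /and5P[_ _ _ + _] := ratom_profile v.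
  rewrite size_map -/(msize v) (_ : msize v = 3%N) ?eqxx ?implyTb; last by lia.
  move/hasP => [g gpos]; rewrite -(Pus _ gpos) (parity_pr _ e) (perm_parity _ pvs).
  rewrite parity_cons parity2 ?addbF ?eqxx //.
  by move=> w /vs2/is2.
have [vs2|[v [vs' [pvs v3 _]]]] := sum_le1 (leq_trans (leq_addl _ _) small); last first.
  by move: small; rewrite (perm_big _ pus) (perm_big _ pvs) !big_cons u4 v3 /=; lia.
(* The exception is [u], of length 4: the even number of atoms in [us'] contributes nothing, so all
   parities of [u] would vanish, which its profile excludes. *)
have /and5P[_ _ + _ _] := ratom_profile u.
rewrite size_map -/(msize u) (_ : msize u = 4%N) ?eqxx ?implyTb; last by lia.
move/hasP => [g gpos].
have := parity_pr g e; rewrite (parity2 (us := vs)) //; last by move=> w /vs2/is2.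
rewrite (perm_parity _ pus) parity_cons (parity5 (us := us')) //; last first.
  by move=> w /us5/is5.
by move: us_odd; rewrite (perm_size pus) /= => /negPf ->; rewrite addbF => ->.
Qed.

(** Counting primes gives [2 * size vs <= 3 * size us]; rounding down yields the bound, also for odd
    [size us]. *)
Lemma length_bound3 us vs :
  (forall u, (msize u <= 3)%N) -> pr us = pr vs ->
  (size vs <= max_length 3 (size us))%N.
Proof.
move=> le3 e; rewrite /max_length.
have := supp_ge (psi := psi) (n := 2) (us := vs) (fun u _ => proj1 (andP (msize_bounds u))).
have := supp_le (psi := psi) (n := 3) (us := us) (fun u _ => le3 u).
rewrite -!(size_psi_pr psiD) e.
have := odd_double_half (size us); lia.
Qed.

End LengthBounds.

(** * Minimal zero-sum multisets and their images under injective homomorphisms *)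

Lemma mset_addIr (K : choiceType) (C : multiset K) :
  injective (fun A : multiset K => A + C).
Proof. exact: can_inj (msetDKBC C). Qed.

Lemma minimal_zero_sumE (G : zmodType) (S : multiset G) :
  minimal_zero_sum S <-> minimal_zs (S : seq G).
Proof.
split=> [[S0 sumS dec]|[S0 sumS dec]]; split.
- by apply: contra_notN S0 => S0; apply/eqP; rewrite -size_mset_eq0 size_eq0.
- by rewrite lsumE.
- move=> s1 s2 p s10; apply: contrapT => /not_orP[n1 n2].
  have Ss : S = seq_mset s1 + seq_mset s2 :> multiset G.
    by rewrite -seq_mset_cat; apply: mset_of_perm.
  have sz (s : seq G) : s <> [::] -> (0 < size s)%N by case: s.
  have sE s : size (seq_mset s : multiset G) = size s.
    by rewrite (perm_size (perm_eq_seq_mset s)).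
  apply: (dec (seq_mset s1)).
  + apply/msubsetP => g; rewrite Ss msetE2; exact: leq_addr.
  + by move=> E; have := sz _ n1; rewrite -sE E size_mset0.
  + move=> E; have := sz _ n2.
    by rewrite -(ltn_add2l (size s1)) addn0 -{1}(sE s1) E Ss size_msetD !sE ltnn.
  + by rewrite /zero_sum (perm_big _ (perm_eq_seq_mset s1)) -lsumE.
- by move=> E; move: S0; rewrite E enum_mset0.
- by rewrite /zero_sum -lsumE.
- move=> T TS T0 nTS sumT.
  have p : perm_eq S ((T : seq G) ++ (S `\` T)%mset).
    have := perm_msetD T (S `\` T)%mset.
    by rewrite (_ : T + (S `\` T)%mset = S) //; apply: msetBDKC.
  have [|E|E] := dec _ _ p; first by rewrite lsumE.
    by apply: T0; apply/eqP; rewrite -size_mset_eq0 E.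
  apply: nTS; apply/esym/perm_mset; apply: perm_trans p _.
  by rewrite E cats0.
Qed.

Lemma minimal_zs_map (G V : zmodType) (f : G -> V) (s : seq G) :
  (forall x y, f (x + y) = f x + f y) -> (forall x, f x = 0 -> x = 0) ->
  minimal_zs [seq f x | x <- s] <-> minimal_zs s.
Proof.
move=> fD f0; have f00 : f 0 = 0 by apply: (addrI (f 0)); rewrite -fD !addr0.
have fsum t : lsum [seq f x | x <- t] = f (lsum t).
  by elim: t => [|x t IH] //=; rewrite IH fD.
split=> -[s0 sum_s dec]; split.
- by move: s0; rewrite -!size_eq0 size_map.
- by apply: f0; rewrite -fsum.
- move=> s1 s2 p s10; have := dec (map f s1) (map f s2).
  rewrite -map_cat fsum s10 => /(_ (perm_map f p) f00).
  by case=> /(congr1 size); rewrite size_map => /size0nil; [left|right].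
- by move: s0; rewrite -!size_eq0 size_map.
- by rewrite fsum sum_s.
- move=> _ _ /perm_map_cat[t1 [t2 [p <- <-]]]; rewrite fsum => /f0 t10.
  by case: (dec _ _ p t10) => ->; [left|right].
Qed.

(** * The block structure of a Krull monoid *)

Section KrullReduction.
Context (H : nmodType) (P : choiceType) (phi : {additive H -> multiset P}).
Hypothesis phi_div : divisor_hom phi.

Local Notation Cl := (class_group phi).

(** The choice of representative is immaterial because [phi] sends units to 0; see
    [red_phi_coset]. *)
Definition red_phi (x : reduced_monoid H) : multiset P := phi (repr x).

Lemma phi_invertible a : invertible a -> phi a = 0.
Proof.
move=> [b ab]; have : size (phi a + phi b : multiset P) = 0%N.
  by rewrite -raddfD ab raddf0 size_mset0.
rewrite size_msetD => sz; apply/eqP; rewrite -size_mset_eq0.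
by apply/eqP; lia.
Qed.

Lemma red_phi_coset a : red_phi (coset a) = phi a.
Proof.
have : assoc a (repr (coset a)).
  by have /eqmodP := esym (reprK (coset a)).
move=> /asboolP[e /phi_invertible e0 E]; rewrite /red_phi E raddfD.
by rewrite e0 addr0.
Qed.

Lemma cosetK (x : reduced_monoid H) : coset (repr x) = x.
Proof. exact: reprK. Qed.

Lemma coset_add a b : coset (a + b) = coset a + coset b :> reduced_monoid H.
Proof. exact: pi_red_add. Qed.

Lemma red_phiD x y : red_phi (x + y) = red_phi x + red_phi y.
Proof.
by rewrite -[x]cosetK -[y]cosetK -coset_add !red_phi_coset raddfD.
Qed.

(** Equal images give divisibility of the representatives; the quotient [c] has image 0, so it
    divides 0 and is a unit. *)
Lemma red_phi_inj : injective red_phi.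
Proof.
move=> x y E; rewrite -[x]reprK -[y]reprK; apply/eqmodP/asboolP.
have [c yxc] : divides (repr x) (repr y).
  by apply: phi_div; exists 0; rewrite addr0; apply/esym.
exists c => //; have c0 : phi c = 0.
  apply: (@mset_addIr _ (phi (repr x))).
  by rewrite /= add0r addrC -raddfD -yxc; apply/esym.
have [d cd] : divides c 0.
  by apply: phi_div; exists 0; rewrite c0 raddf0 addr0.
by exists d.
Qed.

Lemma coeff_mset_freeg p (A : multiset P) :
  coeff p (mset_freeg A) = (A p)%:Z.
Proof.
rewrite /mset_freeg raddf_sum -count_mem_mset /=.
elim: (A : seq P) => [|q s IH]; first by rewrite big_nil.
by rewrite big_cons IH coeffU mul1r /= PoszD; case: (q == p).
Qed.

Lemma mset_freeg_inj : injective (@mset_freeg P).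
Proof.
move=> A B E; apply/msetP => p.
by have := congr1 (coeff p) E; rewrite !coeff_mset_freeg => -[].
Qed.

Lemma sum_prime_class (A : multiset P) :
  \sum_(p <- A) prime_class phi p =
  \pi_(Quotient.quot (principal_zmod phi)) (mset_freeg A) :> Cl.
Proof.
rewrite /mset_freeg; elim: (A : seq P) => [|q s IH].
  by rewrite !big_nil; apply/esym; exact: raddf0.
by rewrite !big_cons IH; apply/esym; exact: raddfD.
Qed.

(** If the class of [A] is zero, then [A + phi b = phi a] for some [a] and [b]. Hence [b] divides
    [a], and the quotient has image [A] by cancellation. *)
Lemma sum_prime_class_eq0 (A : multiset P) :
  \sum_(p <- A) prime_class phi p = 0 <-> exists a, phi a = A.
Proof.
rewrite sum_prime_class; split=> [/eqP|[a <-]].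
  have <- : \pi_(Quotient.quot (principal_zmod phi)) 0 = 0 :> Cl.
    exact: raddf0.
  rewrite -Quotient.idealrBE subr0 => /asboolP[a [b E]].
  have Eab : A + phi b = phi a.
    by apply: mset_freeg_inj; rewrite mset_freegD E addrNK.
  have [c abc] : divides b a by apply: phi_div; exists A; rewrite addrC Eab.
  exists c; move: Eab; rewrite abc raddfD [phi b + _]addrC.
  by move=> /mset_addIr.
apply/eqP; have <- : \pi_(Quotient.quot (principal_zmod phi)) 0 = 0 :> Cl.
  exact: raddf0.
rewrite -Quotient.idealrBE subr0; apply/asboolP; exists a, 0.
by rewrite raddf0 /mset_freeg big_mset0 subr0.
Qed.

Variables (co : Cl -> vec) (G : seq vec) (D : nat).
Hypothesis coD : forall x y, co (x + y) = co x + co y.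
Hypothesis co_eq0 : forall x, co x = 0 -> x = 0.
Hypothesis coG : forall v, v \in G <-> exists p, co (prime_class phi p) = v.

Definition prime_vec (p : P) : vec := co (prime_class phi p).

Lemma prime_vecG p : prime_vec p \in G.
Proof. by apply/coG; exists p. Qed.

Lemma lsum_prime_vec (A : seq P) :
  lsum [seq prime_vec p | p <- A] = co (\sum_(p <- A) prime_class phi p).
Proof.
have co0 : co 0 = 0 by apply: (addrI (co 0)); rewrite -coD !addr0.
by elim: A => [|p A IH]; rewrite ?big_nil //= big_cons coD IH.
Qed.

Lemma red_phi_zs x : lsum [seq prime_vec p | p <- red_phi x] = 0.
Proof.
rewrite lsum_prime_vec (_ : \sum_(p <- _) _ = 0).
  by apply: (addrI (co 0)); rewrite -coD !addr0.
by apply/sum_prime_class_eq0; exists (repr x).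
Qed.

Lemma red_phi_onto (A : multiset P) :
  lsum [seq prime_vec p | p <- A] = 0 -> exists x, red_phi x = A.
Proof.
rewrite lsum_prime_vec => /co_eq0 /sum_prime_class_eq0 [a <-].
by exists (coset a); apply: red_phi_coset.
Qed.

Lemma prime_vec_section : G != [::] ->
  exists pp : vec -> P, {in G, cancel pp prime_vec}.
Proof.
case: G coG => // g0 G' HG _.
have [p0 _] := (proj1 (HG g0)) (mem_head _ _).
(* The prime [p0] is a default for vectors that are not classes of primes. *)
exists (fun v => if pselect (exists p, prime_vec p = v) is left ex
  then projT1 (cid ex) else p0).
move=> v /HG ex; case: pselect => // ex'.
exact: (projT2 (cid ex')).
Qed.

Lemma davenportE s :
  minimal_zs s -> {subset s <= G} -> size s = D ->
  (forall t, minimal_zs t -> {subset t <= G} -> (size t <= D)%N) ->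
  davenport (prime_classes phi) = Some D.
Proof.
move=> min_s sG sD Dmax.
have G0 : G != [::].
  by case: (s) min_s sG => [[] //|g t] _ /(_ _ (mem_head _ _)); case: G.
have [pp ppK] := prime_vec_section G0.
have co_pp : [seq co g | g <- [seq prime_class phi (pp v) | v <- s]] = s.
  rewrite -map_comp -[RHS]map_id; apply/eq_in_map => v /sG.
  exact: ppK.
apply: enat_sup_max.
  pose S : multiset Cl := seq_mset [seq prime_class phi (pp v) | v <- s].
  have pS := perm_eq_seq_mset [seq prime_class phi (pp v) | v <- s].
  exists S; last by rewrite (perm_size pS) size_map sD.
  split; last by move=> g; rewrite (perm_mem pS) => /mapP[v _ ->]; exists (pp v).
  apply/minimal_zero_sumE; apply: (@perm_minimal_zs _ _ _ _).
    by rewrite perm_sym; apply: pS.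
  by apply/(minimal_zs_map _ coD co_eq0); rewrite co_pp.
move=> _ [S [/minimal_zero_sumE min_S SG] <-] /=.
rewrite -(size_map co); apply: Dmax.
  by apply/(minimal_zs_map _ coD co_eq0).
by move=> _ /mapP[g /SG[p _ <-] ->]; apply: prime_vecG.
Qed.

End KrullReduction.

(** * Coordinates on the class group *)

Section Coordinates.
Context (G : zmodType) (r : nat) (e : 'I_r -> G).
Hypothesis e_basis : free_basis e.

Lemma coordinates_exist :
  exists c : G -> {ffun 'I_r -> int},
    [/\ forall g h, c (g + h) = [ffun i => c g i + c h i],
        forall g, (forall i, c g i = 0) -> g = 0
      & forall eps : {ffun 'I_r -> bool},
          c (\sum_(i < r) e i *+ eps i) = [ffun i => (eps i : nat)%:Z]].
Proof.
pose c g := projT1 (cid (e_basis g)).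
have cE g : g = \sum_(i < r) e i *~ c g i.
  by rewrite /c; case: cid => d [].
have cU g d : g = \sum_(i < r) e i *~ (d : {ffun _ -> _}) i -> c g = d.
  by rewrite /c; case: cid => d' [? U] /U.
exists c; split.
- move=> g h; apply: cU; rewrite {1}(cE g) {1}(cE h) -big_split.
  by apply: eq_bigr => i _; rewrite ffunE mulrzDr.
- by move=> g g0; rewrite (cE g) big1 // => i _; rewrite g0.
- by move=> eps; apply: cU; apply: eq_bigr => i _; rewrite ffunE.
Qed.

End Coordinates.
Lemma mem_signed (pos : seq vec) (v : vec) :
  (v \in pos ++ [seq - x | x <- pos]) = (v \in pos) || (- v \in pos).
Proof.
rewrite mem_cat; congr (_ || _).
by rewrite -{1}[v]opprK mem_map //; apply: oppr_inj.
Qed.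

Lemma signed_prime_vectors (H : nmodType) (P : choiceType)
    (phi : {additive H -> multiset P}) (r : nat) (e : 'I_r -> class_group phi)
    (co : class_group phi -> vec) (pos : seq vec) :
  prime_classes phi = Gplus e `|` [set - g | g in Gplus e] ->
  (forall x y, co (x + y) = co x + co y) ->
  (forall v, v \in pos <-> exists2 g, Gplus e g & co g = v) ->
  forall v, v \in pos ++ [seq - x | x <- pos] <->
    exists p, co (prime_class phi p) = v.
Proof.
move=> clE coD posE v.
have coN x : co (- x) = - co x.
  apply: (addrI (co x)); rewrite -coD !subrr.
  by apply: (addrI (co 0)); rewrite -coD !addr0.
have primeE g : prime_classes phi g <-> exists p, prime_class phi p = g.
  by split=> [[p _ <-]|[p <-]]; exists p.
rewrite mem_signed; split.
  case/orP => /posE [g eg cog].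
    have /primeE[p pg] : prime_classes phi g by rewrite clE; left.
    by exists p; rewrite pg.
  have /primeE[p pg] : prime_classes phi (- g) by rewrite clE; right; exists g.
  by exists p; rewrite pg coN cog opprK.
move=> [p <-]; have : prime_classes phi (prime_class phi p) by apply/primeE; exists p.
rewrite clE => -[eg|[g eg <-]]; apply/orP; [left|right]; apply/posE.
  by exists (prime_class phi p).
by exists g; rewrite // coN opprK.
Qed.

Lemma positive_vectors3 (G : zmodType) (e : 'I_3 -> G) (co : G -> vec) :
  (forall eps : {ffun 'I_3 -> bool}, co (\sum_(i < 3) e i *+ eps i) =
     mkvec (eps (@Ordinal 3 0 isT) : nat)%:Z (eps (@Ordinal 3 1 isT) : nat)%:Z
       (eps (@Ordinal 3 2 isT) : nat)%:Z) ->
  forall v, v \in pos3 <-> exists2 g, Gplus e g & co g = v.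
Proof.
move=> coE v; split=> [|[_ [eps [[i epsi] ->]] <-]].
  pose bits (v : vec) := [:: v.1.1 == 1; v.1.2 == 1; v.2 == 1].
  move=> vpos.
  pose eps : {ffun 'I_3 -> bool} := [ffun i : 'I_3 => nth false (bits v) i].
  exists (\sum_(i < 3) e i *+ eps i); last first.
    rewrite coE !ffunE; move: vpos; rewrite !inE.
    by do 6?case/orP; move=> /eqP ->.
  exists eps; split=> //; move: vpos; rewrite /eps !inE.
  by do 6?case/orP; move=> /eqP ->;
    (by exists (@Ordinal 3 0 isT); rewrite ffunE)
    || (by exists (@Ordinal 3 1 isT); rewrite ffunE)
    || (by exists (@Ordinal 3 2 isT); rewrite ffunE).
rewrite coE.
have : [|| eps (@Ordinal 3 0 isT), eps (@Ordinal 3 1 isT) | eps (@Ordinal 3 2 isT)].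
  move: epsi; case: i => -[|[|[|//]]] lt_i;
    by rewrite (bool_irrelevance lt_i isT) => ->; rewrite ?orbT.
by case: (eps _); case: (eps _); case: (eps _).
Qed.

Lemma positive_vectors2 (G : zmodType) (e : 'I_2 -> G) (co : G -> vec) :
  (forall eps : {ffun 'I_2 -> bool}, co (\sum_(i < 2) e i *+ eps i) =
     mkvec (eps (@Ordinal 2 0 isT) : nat)%:Z (eps (@Ordinal 2 1 isT) : nat)%:Z 0) ->
  forall v, v \in pos2 <-> exists2 g, Gplus e g & co g = v.
Proof.
move=> coE v; split=> [|[_ [eps [[i epsi] ->]] <-]].
  pose bits (v : vec) := [:: v.1.1 == 1; v.1.2 == 1].
  move=> vpos.
  pose eps : {ffun 'I_2 -> bool} := [ffun i : 'I_2 => nth false (bits v) i].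
  exists (\sum_(i < 2) e i *+ eps i); last first.
    rewrite coE !ffunE; move: vpos; rewrite !inE.
    by do 2?case/orP; move=> /eqP ->.
  exists eps; split=> //; move: vpos; rewrite /eps !inE.
  by do 2?case/orP; move=> /eqP ->;
    (by exists (@Ordinal 2 0 isT); rewrite ffunE)
    || (by exists (@Ordinal 2 1 isT); rewrite ffunE).
rewrite coE.
have : eps (@Ordinal 2 0 isT) || eps (@Ordinal 2 1 isT).
  move: epsi; case: i => -[|[|//]] lt_i;
    by rewrite (bool_irrelevance lt_i isT) => ->; rewrite ?orbT.
by case: (eps _); case: (eps _).
Qed.

(** * The concrete data in ranks 2 and 3 *)

Lemma classesN3 g : g \in classes3 -> - g \in classes3.
Proof. by rewrite !mem_signed opprK orbC. Qed.

Lemma classesN2 g : g \in classes2 -> - g \in classes2.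
Proof. by rewrite !mem_signed opprK orbC. Qed.

Lemma zs_lengths5 d : (2 <= d <= 5)%N ->
  exists2 s, minimal_zs s & {subset s <= classes3} /\ size s = d.
Proof.
case: d => [|[|[|[|[|[|]]]]]] // _.
- exists [:: mkvec 1 0 0; mkvec (-1) 0 0]; first by apply: minimal_zsbP.
  by split=> //; apply/allP.
- exists triangle; first by apply: minimal_zsbP.
  by split=> //; apply/allP.
- exists square; first by apply: minimal_zsbP.
  by split=> //; apply/allP.
- exists pentagon; first by apply: minimal_zsbP.
  by split=> //; apply/allP.
Qed.

Lemma zs_lengths3 d : (2 <= d <= 3)%N ->
  exists2 s, minimal_zs s & {subset s <= classes2} /\ size s = d.
Proof.
case: d => [|[|[|[|]]]] // _.
- exists [:: mkvec 1 0 0; mkvec (-1) 0 0]; first by apply: minimal_zsbP.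
  by split=> //; apply/allP.
- exists triangle; first by apply: minimal_zsbP.
  by split=> //; apply/allP.
Qed.

Lemma zs_size3 s : minimal_zs s -> {subset s <= classes3} -> (size s <= 5)%N.
Proof. by move=> min_s /(minimal_zs_profile min_s) /andP[]. Qed.

Lemma classes2_sub : {subset classes2 <= classes3}.
Proof. by apply/allP. Qed.

(** In rank 2 all last coordinates are 0, so the last clause of the rank 3 profile applies. *)
Lemma zs_plane s : minimal_zs s -> {subset s <= classes2} ->
  (size s <= 3)%N && ((size s == 3%N) ==>
     perm_eq s triangle || perm_eq s [seq - x | x <- triangle]).
Proof.
move=> min_s sG.
have /and5P[_ _ _ _ /andP[_ /implyP]] : zs_profile s.
  by apply: minimal_zs_profile => // v /sG/classes2_sub.
apply; apply/allP => v /sG.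
by move: v; apply/allP.
Qed.

(** * The invariants in both ranks *)

Section Conclusion.
Context (H : nmodType) (P : choiceType) (phi : {additive H -> multiset P}).
Hypothesis phi_div : divisor_hom phi.
Variable co : class_group phi -> vec.
Hypothesis coD : forall x y, co (x + y) = co x + co y.
Hypothesis co_eq0 : forall x, co x = 0 -> x = 0.

Lemma rank2_conclusion :
  (forall v, v \in classes2 <-> exists p, co (prime_class phi p) = v) ->
  [/\ catenary_degree H = Some 3%N,
      tame_degree H = Some 3%N,
      davenport (prime_classes phi) = Some 3%N,
      (forall k : nat, (2 <= k)%N -> nat_interval (unions_of_lengths H k))
    & forall k j : nat, (2 <= k)%N -> (j <= 1)%N ->
        elasticity H (2 * k + j)%N = Some (3 * k + j)%N].
Proof.
move=> coG; have [//|pp ppK] := prime_vec_section coG.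
have psiD := red_phiD phi; have psi_inj := red_phi_inj phi_div.
have psi_zs := red_phi_zs phi_div coD.
have psi_onto := red_phi_onto phi_div coD co_eq0.
have clG := prime_vecG coG.
have G0 : 0 \notin classes2 by [].
have Dmax s : minimal_zs s -> {subset s <= classes2} -> (size s <= 3)%N.
  by move=> min_s /(zs_plane min_s)/andP[].
have min_T : minimal_zs triangle by apply: minimal_zsbP.
have TG : {subset triangle <= classes2} by apply/allP.
have bound (us vs : seq (red_atom H)) :
    pr us = pr vs -> (size vs <= max_length 3 (size us))%N.
  apply: (length_bound3 psiD psi_inj psi_zs psi_onto) => [p|u].
    by apply/classes2_sub/clG.
  exact: (msize_leD psiD psi_inj psi_zs psi_onto clG Dmax).
split.
- apply: (catenary_degreeE psiD psi_inj psi_zs psi_onto clG G0 Dmax ppK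
            classesN2 min_T) => //.
  by apply: only_opposite_atoms; vm_compute.
- apply: (tame_degreeE psiD psi_inj psi_zs psi_onto clG G0 Dmax ppK
            classesN2 min_T) => //.
    by apply/allP.
  move=> s min_s /(zs_plane min_s)/andP[_ /implyP + s3].
  by rewrite s3 => /(_ isT) /orP.
- exact: (davenportE coD co_eq0 coG min_T TG _ Dmax).
- move=> k _.
  exact: (unions_of_lengths_interval psiD psi_inj psi_zs psi_onto G0 ppK
            classesN2 zs_lengths3 _ bound).
- move=> k j _ j1.
  rewrite (elasticityE psiD psi_inj psi_zs psi_onto G0 ppK
             classesN2 zs_lengths3 _ bound) // /max_length.
  congr Some; case: j j1 => [|[|]] // _; have := odd_double_half k; lia.
Qed.

Lemma rank3_conclusion :
  (forall v, v \in classes3 <-> exists p, co (prime_class phi p) = v) ->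
  [/\ catenary_degree H = Some 5%N,
      davenport (prime_classes phi) = Some 5%N,
      (forall k : nat, (2 <= k)%N -> nat_interval (unions_of_lengths H k))
    & forall k j : nat, (2 <= k)%N -> (j <= 1)%N ->
        elasticity H (2 * k + j)%N = Some (5 * k + j)%N].
Proof.
move=> coG; have [//|pp ppK] := prime_vec_section coG.
have psiD := red_phiD phi; have psi_inj := red_phi_inj phi_div.
have psi_zs := red_phi_zs phi_div coD.
have psi_onto := red_phi_onto phi_div coD co_eq0.
have clG := prime_vecG coG.
have G0 : 0 \notin classes3 by [].
have min_U : minimal_zs pentagon by apply: minimal_zsbP.
have UG : {subset pentagon <= classes3} by apply/allP.
have bound (us vs : seq (red_atom H)) :
    pr us = pr vs -> (size vs <= max_length 5 (size us))%N.
  exact: (length_bound5 psiD psi_inj psi_zs psi_onto clG).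
split.
- apply: (catenary_degreeE psiD psi_inj psi_zs psi_onto clG G0 zs_size3 ppK
            classesN3 min_U) => //.
  by apply: only_opposite_atoms; vm_compute.
- exact: (davenportE coD co_eq0 coG min_U UG _ zs_size3).
- move=> k _.
  exact: (unions_of_lengths_interval psiD psi_inj psi_zs psi_onto G0 ppK
            classesN3 zs_lengths5 _ bound).
- move=> k j _ j1.
  rewrite (elasticityE psiD psi_inj psi_zs psi_onto G0 ppK
             classesN3 zs_lengths5 _ bound) // /max_length.
  congr Some; case: j j1 => [|[|]] // _; have := odd_double_half k; lia.
Qed.

End Conclusion.

Theorem corollary4p6 (H : nmodType) (P : choiceType)
    (phi : {additive H -> multiset P})
    (r : nat) (e : 'I_r -> class_group phi) :
  cancellative H -> krull H -> divisor_theory phi ->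
  r = 2%N \/ r = 3%N ->
  free_basis e ->
  prime_classes phi = Gplus e `|` [set - g | g in Gplus e] ->
  (r = 2%N ->
    [/\ catenary_degree H = Some 3%N,
        tame_degree H = Some 3%N,
        davenport (prime_classes phi) = Some 3%N,
        (forall k : nat, (2 <= k)%N -> nat_interval (unions_of_lengths H k))
      & forall k j : nat, (2 <= k)%N -> (j <= 1)%N ->
          elasticity H (2 * k + j)%N = Some (3 * k + j)%N]) /\
  (r = 3%N ->
    [/\ catenary_degree H = Some 5%N,
        davenport (prime_classes phi) = Some 5%N,
        (forall k : nat, (2 <= k)%N -> nat_interval (unions_of_lengths H k))
      & forall k j : nat, (2 <= k)%N -> (j <= 1)%N ->
          elasticity H (2 * k + j)%N = Some (5 * k + j)%N]).
Proof.
move=> _ _ [phi_div _] _ e_basis clE; split=> r_eq; subst r.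
- have [c [cD c0 cE]] := coordinates_exist e_basis.
  pose co g := mkvec (c g (@Ordinal 2 0 isT)) (c g (@Ordinal 2 1 isT)) 0.
  have coD x y : co (x + y) = co x + co y by rewrite /co cD !ffunE.
  have co_eq0 x : co x = 0 -> x = 0.
    case=> x0 x1; apply: c0; case=> -[|[|//]] lt_i;
      by rewrite (bool_irrelevance lt_i isT).
  apply: (rank2_conclusion phi_div coD co_eq0).
  apply: (signed_prime_vectors clE coD); apply: positive_vectors2 => eps.
  by rewrite /co cE !ffunE.
- have [c [cD c0 cE]] := coordinates_exist e_basis.
  pose co g := mkvec (c g (@Ordinal 3 0 isT)) (c g (@Ordinal 3 1 isT))
                 (c g (@Ordinal 3 2 isT)).
  have coD x y : co (x + y) = co x + co y by rewrite /co cD !ffunE.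
  have co_eq0 x : co x = 0 -> x = 0.
    case=> x0 x1 x2; apply: c0; case=> -[|[|[|//]]] lt_i;
      by rewrite (bool_irrelevance lt_i isT).
  apply: (rank3_conclusion phi_div coD co_eq0).
  apply: (signed_prime_vectors clE coD); apply: positive_vectors3 => eps.
  by rewrite /co cE !ffunE.
Qed.
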